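(* For every integer $n\geq 2$, every real $\alpha>1/2$ and every $\varepsilon>0$, there exists a bounded, smooth, strictly horo-convex domain $\Omega\subset\mathbb{H}^n$ with $\mathrm{diam}(\Omega)<\varepsilon$ such that $u^\alpha$ is not concave in $\Omega$, where $u$ denotes the torsion function of $\Omega$.
   Context: $\mathbb{H}^n$ is the $n$-dimensional hyperbolic space of constant sectional curvature $-1$ with metric $g$; $\Delta$ is its Laplace-Beltrami operator (the trace of the Hessian) and $\mathrm{diam}$ is the diameter with respect to the hyperbolic distance. A domain is a connected open set; a smooth domain is one with smooth boundary. The torsion function of a bounded smooth domain $\Omega$ is the unique solution $u$ of $\Delta u=-2$ in $\Omega$, $u=0$ on $\partial\Omega$; it is positive in $\Omega$. A smooth bounded domain $\Omega\subset\mathbb{H}^n$ is strictly horo-convex if $\mathrm{II}_{\partial\Omega}>g_{\partial\Omega}$ as quadratic forms at every point of $\partial\Omega$, i.e. all principal curvatures of $\partial\Omega$ are strictly greater than $1$; here $g_{\partial\Omega}$ is the induced metric and $\mathrm{II}_{\partial\Omega}$ is the second fundamental form with respect to the outward unit normal $\nu$, with the sign convention $\mathrm{II}(e,e)=\langle\nabla_e\nu,e\rangle$, so that geodesic spheres have positive second fundamental form. Concavity of functions is understood along geodesics of $\mathbb{H}^n$ contained in $\Omega$. *)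

(* Defs.v *)
(* Hyperbolic space is the upper half-space with the metric
   |dx|^2 / x_last^2; all Riemannian notions are the usual coordinate
   expressions for an arbitrary metric [g] on an open subset [M] of R^n. *)
From HB Require Import structures.
From mathcomp Require Import all_boot all_order all_algebra.
From mathcomp Require Import all_classical all_reals all_analysis.

Set Implicit Arguments.
Unset Strict Implicit.
Unset Printing Implicit Defensive.

Import Order.TTheory GRing.Theory Num.Theory.
Import numFieldNormedType.Exports.

Local Open Scope classical_set_scope.
Local Open Scope ring_scope.

Definition partial (R : realType) (n : nat) (i : 'I_n) (f : 'rV[R]_n -> R)
  : 'rV[R]_n -> R := fun x => 'D_(delta_mx 0 i) f x.

(* C^k on a set U that is meant to be open *)
Fixpoint Ck (R : realType) (n k : nat) (U : set 'rV[R]_n) (f : 'rV[R]_n -> R)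
  : Prop :=
  match k with
  | 0 => forall x, U x -> {for x, continuous f}
  | k'.+1 => (forall x, U x -> differentiable f x) /\
             (forall i, Ck k' U (partial i f))
  end.

Definition smooth (R : realType) (n : nat) (U : set 'rV[R]_n)
    (f : 'rV[R]_n -> R) : Prop :=
  forall k, Ck k U f.

Definition inner (R : realType) (n : nat) (g : 'rV[R]_n -> 'M[R]_n)
    (x v w : 'rV[R]_n) : R :=
  (v *m g x *m w^T) 0 0.

(* Gamma^k_ij of the Levi-Civita connection *)
Definition christoffel (R : realType) (n : nat) (g : 'rV[R]_n -> 'M[R]_n)
    (k i j : 'I_n) (x : 'rV[R]_n) : R :=
  2^-1 * \sum_(l < n) invmx (g x) k l *
    (partial i (fun y => g y j l) x + partial j (fun y => g y i l) x
     - partial l (fun y => g y i j) x).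

Definition nabla (R : realType) (n : nat) (g : 'rV[R]_n -> 'M[R]_n)
    (e : 'rV[R]_n) (X : 'rV[R]_n -> 'rV[R]_n) (x : 'rV[R]_n) : 'rV[R]_n :=
  'D_e X x +
  \row_(k < n) \sum_(i < n) \sum_(j < n) christoffel g k i j x * e 0 i * X x 0 j.

Definition gradient (R : realType) (n : nat) (g : 'rV[R]_n -> 'M[R]_n)
    (f : 'rV[R]_n -> R) (x : 'rV[R]_n) : 'rV[R]_n :=
  (\row_(i < n) partial i f x) *m invmx (g x).

Definition hessian (R : realType) (n : nat) (g : 'rV[R]_n -> 'M[R]_n)
    (f : 'rV[R]_n -> R) (x : 'rV[R]_n) : 'M[R]_n :=
  \matrix_(i < n, j < n)
    (partial i (partial j f) x
     - \sum_(k < n) christoffel g k i j x * partial k f x).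

Definition laplacian (R : realType) (n : nat) (g : 'rV[R]_n -> 'M[R]_n)
    (f : 'rV[R]_n -> R) (x : 'rV[R]_n) : R :=
  \tr (invmx (g x) *m hessian g f x).

(* A geodesic of (M, g) with its affine parameter in the open interval ]a, b[. *)
Definition geodesic (R : realType) (n : nat) (M : set 'rV[R]_n)
    (g : 'rV[R]_n -> 'M[R]_n) (a b : R) (c : R -> 'rV[R]_n) : Prop :=
  forall t, a < t < b ->
    [/\ M (c t), derivable c t 1, derivable (derive1 c) t 1 &
      forall k : 'I_n,
        derive1 (derive1 c) t 0 k +
        \sum_(i < n) \sum_(j < n)
          christoffel g k i j (c t) * derive1 c t 0 i * derive1 c t 0 j = 0].

Definition geodesically_concave (R : realType) (n : nat) (M : set 'rV[R]_n)
    (g : 'rV[R]_n -> 'M[R]_n) (Omega : set 'rV[R]_n) (f : 'rV[R]_n -> R)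
  : Prop :=
  forall (a b : R) (c : R -> 'rV[R]_n),
    geodesic M g a b c -> (forall t, a < t < b -> Omega (c t)) ->
    convex_function `]a, b[ (fun t : R^o => - f (c t) : R^o).

Definition curve_length (R : realType) (n : nat) (g : 'rV[R]_n -> 'M[R]_n)
    (c : R -> 'rV[R]_n) : \bar R :=
  (\int[lebesgue_measure]_(t in `[0%R, 1%R])
     (Num.sqrt (inner g (c t) (derive1 c t) (derive1 c t)))%:E)%E.

(* C^1 curves from x to y in M, parametrized by [0, 1]; they are taken to be
   C^1 on all of R (as maps to R^n), since a C^1 curve on [0, 1] extends. *)
Definition curve_between (R : realType) (n : nat) (M : set 'rV[R]_n)
    (x y : 'rV[R]_n) (c : R -> 'rV[R]_n) : Prop :=
  [/\ forall t, derivable c t 1, continuous (derive1 c),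
      forall t, 0 <= t <= 1 -> M (c t), c 0 = x & c 1 = y].

Definition rdist (R : realType) (n : nat) (M : set 'rV[R]_n)
    (g : 'rV[R]_n -> 'M[R]_n) (x y : 'rV[R]_n) : \bar R :=
  ereal_inf [set curve_length g c | c in curve_between M x y].

Definition diam (R : realType) (n : nat) (M : set 'rV[R]_n)
    (g : 'rV[R]_n -> 'M[R]_n) (Omega : set 'rV[R]_n) : \bar R :=
  ereal_sup [set rdist M g p.1 p.2 | p in Omega `*` Omega].

Definition domain (R : realType) (n : nat) (M Omega : set 'rV[R]_n) : Prop :=
  [/\ Omega `<=` M, open Omega, connected Omega & Omega !=set0].

Definition boundary (R : realType) (n : nat) (M Omega : set 'rV[R]_n)
  : set 'rV[R]_n :=
  M `&` (closure Omega `\` interior Omega).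

(* Near p the domain is {rho < 0}, with rho smooth and d rho <> 0 at p. *)
Definition defining_function (R : realType) (n : nat) (Omega : set 'rV[R]_n)
    (p : 'rV[R]_n) (U : set 'rV[R]_n) (rho : 'rV[R]_n -> R) : Prop :=
  [/\ open U, U p, smooth U rho,
      forall x, U x -> (Omega x <-> rho x < 0) &
      exists i, partial i rho p != 0].

Definition smooth_domain (R : realType) (n : nat) (M Omega : set 'rV[R]_n)
  : Prop :=
  domain M Omega /\
  forall p, boundary M Omega p ->
    exists U rho, defining_function Omega p U rho.

(* The unit normal to the level sets of rho, pointing towards larger values of
   rho; outward when rho is a defining function. *)
Definition unit_normal (R : realType) (n : nat) (g : 'rV[R]_n -> 'M[R]_n)
    (rho : 'rV[R]_n -> R) (x : 'rV[R]_n) : 'rV[R]_n :=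
  (Num.sqrt (inner g x (gradient g rho x) (gradient g rho x)))^-1
    *: gradient g rho x.

Definition second_fundamental_form (R : realType) (n : nat)
    (g : 'rV[R]_n -> 'M[R]_n) (rho : 'rV[R]_n -> R)
    (p e1 e2 : 'rV[R]_n) : R :=
  inner g p (nabla g e1 (unit_normal g rho) p) e2.

(* The tangent space and the second fundamental form of the boundary at p do
   not depend on the local defining function used to compute them. *)
Definition strictly_horoconvex (R : realType) (n : nat) (M : set 'rV[R]_n)
    (g : 'rV[R]_n -> 'M[R]_n) (Omega : set 'rV[R]_n) : Prop :=
  forall p, boundary M Omega p ->
    exists U rho, defining_function Omega p U rho /\
      forall e : 'rV[R]_n, inner g p (unit_normal g rho p) e = 0 -> e != 0 ->
        inner g p e e < second_fundamental_form g rho p e e.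

Definition torsion_function (R : realType) (n : nat) (M : set 'rV[R]_n)
    (g : 'rV[R]_n -> 'M[R]_n) (Omega : set 'rV[R]_n) (u : 'rV[R]_n -> R)
  : Prop :=
  [/\ Ck 2 Omega u,
      {within M `&` closure Omega, continuous u},
      forall x, Omega x -> laplacian g u x = - 2 &
      forall x, boundary M Omega x -> u x = 0].

Definition hyp_space (R : realType) (n : nat) : set 'rV[R]_n.+1 :=
  [set x | 0 < x 0 ord_max].

Definition hyp_metric (R : realType) (n : nat) (x : 'rV[R]_n.+1)
  : 'M[R]_n.+1 :=
  ((x 0 ord_max) ^- 2)%:M.

Arguments hyp_space R n : clear implicits.
Arguments hyp_metric R n : clear implicits.

(* Main.v *)
(* In the upper half-space let y be the last coordinate, s the sum of the squares
   of the other ones, and k = m + 1.  Every function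
     u = b y^k (F y - s),
   with F solving y^2 F'' + (k + 1) y F' - 2 k y^2 = - (2 / b) y^-k, satisfies
   Delta u = -2, and it is the torsion function of the spindle {s < F y}.  The
   constants in F can be chosen so that, with t = 1 - y,
     F = theta t^2 - (c / 6) t^3 - delta theta^3 + ...,   c > 0:
   for small theta this is a domain of diameter O(theta) which looks like a cone
   with its tip at t = 0, smoothed at scale sqrt(delta) theta, and closed up at
   t = O(theta).  F''' has a sign, which makes F'^2 - 2 F F'' monotone and hence
   bounded below on the domain by the square of F' at the tip; this gives the
   strict horo-convexity, as the other terms in the second fundamental form are of
   lower order in theta.  On the axis u behaves like t^2 near the tip, so that
   u^alpha behaves like t^(2 alpha) with 2 alpha > 1, and concavity fails at the
   midpoint of a segment of the axis which starts near the tip. *)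
Require Import Defs.
From HB Require Import structures.
From mathcomp Require Import all_boot all_order all_algebra.
From mathcomp Require Import all_classical all_reals all_analysis.
From mathcomp Require Import ring lra.

Set Implicit Arguments.
Unset Strict Implicit.
Unset Printing Implicit Defensive.

Import Order.TTheory GRing.Theory Num.Theory.
Import numFieldNormedType.Exports.

Local Open Scope classical_set_scope.
Local Open Scope ring_scope.

(** * Height profiles of one variable *)

(** With t = theta * tau the profile is, to leading order, theta^3 (tau^2 - (c / 6) tau^3 - delta):
    the spindle has length of order theta but radius of order theta^(3/2), and delta measures the
    rounding of the tip in the rescaled picture. Two demands pull against each other. Failure of
    concavity is tested on the axis between t = om * X * theta and t = X * theta, approximately,
    where X is so small that the cubic term is negligible; the rounding is invisible there only if
    delta is small against (om * X)^2. Convexity, on the other hand, has only the margin F'^2 - 2 F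
    F'' >= theta * (delta * theta^3) left by the rounded tip. Passing from curvatures > 0 to
    curvatures > 1 costs terms of size G * theta^3, where the norm G of the gradient is
    O(theta^(3/2)); this is theta^(9/2) against delta * theta^4, so that theta small against delta^2
    is enough. Hence the constants are fixed in the order [om], [X], [delta], [theta], and [om]
    depends on alpha alone. *)

Lemma is_derive_cc_MVT (R : realType) (f df : R -> R) (a b : R) :
  a < b -> (forall t : R, a <= t <= b -> is_derive t 1 f (df t)) ->
  exists2 c, a < c < b & f b - f a = df c * (b - a).
Proof.
move=> ab fd; have [||c cab ->] := @MVT R f df a b ab.
- by move=> x; rewrite in_itv/= => /andP[? ?]; apply: fd; rewrite !ltW.
- apply: derivable_within_continuous => x; rewrite in_itv/= => xab.
  by have [] := fd x xab.
- by exists c; rewrite // in_itv/= in cab.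
Qed.

Lemma ge0_derive_le (R : realType) (f df : R -> R) (a b : R) :
  a <= b -> (forall t : R, a <= t <= b -> is_derive t 1 f (df t)) ->
  (forall t : R, a <= t <= b -> 0 <= df t) -> f a <= f b.
Proof.
rewrite le_eqVlt => /predU1P[->//|ab] fd df0.
have [c /andP[ac cb] E] := is_derive_cc_MVT ab fd.
rewrite -subr_ge0 E mulr_ge0 ?subr_ge0 ?(ltW ab)//.
by apply: df0; rewrite !ltW.
Qed.

Lemma derive_le (R : realType) (f df g dg : R -> R) (a b t : R) :
  f a = g a -> (forall t : R, a <= t <= b -> is_derive t 1 f (df t)) ->
  (forall t : R, a <= t <= b -> is_derive t 1 g (dg t)) ->
  (forall t : R, a <= t <= b -> df t <= dg t) -> a <= t <= b -> f t <= g t.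
Proof.
move=> fga fd gd dfg /andP[a_t tb].
have tab x : a <= x <= t -> a <= x <= b.
  by case/andP=> -> xt; rewrite (le_trans xt tb).
have : g a - f a <= g t - f t.
  apply: (@ge0_derive_le R (fun t => g t - f t) (fun t => dg t - df t)) => //.
  - by move=> x /tab xab; apply: is_deriveB; [exact: gd|exact: fd].
  - by move=> x /tab xab; rewrite subr_ge0 dfg.
by rewrite fga subrr subr_ge0.
Qed.

(** All that the one-variable estimates use of F: [t] is 1 - y, [f t] is the squared Euclidean
    radius of the cross-section at depth [t], and [mu] is the rounding of the tip. The range up to
    1/2 keeps y away from 0. *)
Record profile (R : realType) (theta mu Lam : R) (f f1 f2 f3 : R -> R) : Prop :=
  Profile {
    profile_derive0 : forall t : R, 0 <= t <= 2^-1 -> is_derive t 1 f (f1 t) ;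
    profile_derive1 : forall t : R, 0 <= t <= 2^-1 -> is_derive t 1 f1 (f2 t) ;
    profile_derive2 : forall t : R, 0 <= t <= 2^-1 -> is_derive t 1 f2 (f3 t) ;
    profile_at0 : f 0 = - mu ;
    profile_at1 : f1 0 = 0 ;
    profile_at2 : f2 0 = 2 * theta ;
    profile_bound3 : forall t : R, 0 <= t <= 2^-1 -> - Lam <= f3 t <= - 1 }.

(** The bounds on [f3], integrated from 0 with the prescribed initial value; the next two lemmas
    integrate twice more. *)
Lemma profile_bound2 (R : realType) (theta mu Lam : R) (f f1 f2 f3 : R -> R) :
  profile theta mu Lam f f1 f2 f3 -> forall t : R, 0 <= t <= 2^-1 ->
  2 * theta - Lam * t <= f2 t <= 2 * theta - t.
Proof.
move=> P t t01; apply/andP; split.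
- apply: (@derive_le R (fun t => 2 * theta - Lam * t) (fun=> - Lam) f2 f3 0 2^-1) => //.
  + by rewrite (profile_at2 P); ring.
  + by move=> x _; apply: is_derive_eq; rewrite /GRing.scale/=; ring.
  + exact: (profile_derive2 P).
  + by move=> x /(profile_bound3 P)/andP[].
- apply: (@derive_le R f2 f3 (fun t => 2 * theta - t) (fun=> - 1) 0 2^-1) => //.
  + by rewrite (profile_at2 P); ring.
  + exact: (profile_derive2 P).
  + by move=> x _; apply: is_derive_eq; rewrite /GRing.scale/=; ring.
  + by move=> x /(profile_bound3 P)/andP[].
Qed.

Lemma profile_bound1 (R : realType) (theta mu Lam : R) (f f1 f2 f3 : R -> R) :
  profile theta mu Lam f f1 f2 f3 -> forall t : R, 0 <= t <= 2^-1 ->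
  2 * theta * t - Lam * t ^+ 2 / 2 <= f1 t <= 2 * theta * t - t ^+ 2 / 2.
Proof.
move=> P t t01; apply/andP; split.
- apply: (@derive_le R (fun t => 2 * theta * t - Lam * t ^+ 2 / 2)
    (fun t => 2 * theta - Lam * t) f1 f2 0 2^-1) => //.
  + by rewrite (profile_at1 P); ring.
  + by move=> x _; apply: is_derive_eq; rewrite /GRing.scale/=; field.
  + exact: (profile_derive1 P).
  + by move=> x /(profile_bound2 P)/andP[].
- apply: (@derive_le R f1 f2 (fun t => 2 * theta * t - t ^+ 2 / 2)
    (fun t => 2 * theta - t) 0 2^-1) => //.
  + by rewrite (profile_at1 P); ring.
  + exact: (profile_derive1 P).
  + by move=> x _; apply: is_derive_eq; rewrite /GRing.scale/=; field.
  + by move=> x /(profile_bound2 P)/andP[].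
Qed.

Lemma profile_bound0 (R : realType) (theta mu Lam : R) (f f1 f2 f3 : R -> R) :
  profile theta mu Lam f f1 f2 f3 -> forall t : R, 0 <= t <= 2^-1 ->
  theta * t ^+ 2 - Lam * t ^+ 3 / 6 - mu <= f t <= theta * t ^+ 2 - t ^+ 3 / 6 - mu.
Proof.
move=> P t t01; apply/andP; split.
- apply: (@derive_le R (fun t => theta * t ^+ 2 - Lam * t ^+ 3 / 6 - mu)
    (fun t => 2 * theta * t - Lam * t ^+ 2 / 2) f f1 0 2^-1) => //.
  + by rewrite (profile_at0 P); ring.
  + by move=> x _; apply: is_derive_eq; rewrite /GRing.scale/=; field.
  + exact: (profile_derive0 P).
  + by move=> x /(profile_bound1 P)/andP[].
- apply: (@derive_le R f f1 (fun t => theta * t ^+ 2 - t ^+ 3 / 6 - mu)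
    (fun t => 2 * theta * t - t ^+ 2 / 2) 0 2^-1) => //.
  + by rewrite (profile_at0 P); ring.
  + exact: (profile_derive0 P).
  + by move=> x _; apply: is_derive_eq; rewrite /GRing.scale/=; field.
  + by move=> x /(profile_bound1 P)/andP[].
Qed.

(* f' vanishes at 0 and f'' decreases, so f' cannot turn from negative to positive. *)
Lemma profile_quasiconcave (R : realType) (theta mu Lam : R) (f f1 f2 f3 : R -> R) :
  profile theta mu Lam f f1 f2 f3 ->
  forall r s t, 0 <= r -> r <= s -> s <= t -> t <= 2^-1 ->
  Num.min (f r) (f t) <= f s.
Proof.
move=> P r s t r0; rewrite le_eqVlt => /predU1P[->|rs]; first by rewrite ge_min lexx.
rewrite le_eqVlt => /predU1P[->|st] t2; first by rewrite ge_min lexx orbT.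
rewrite leNgt lt_min; apply/negP => /andP[fsr fst].
have [c|c /andP[rc cs] fc] := @is_derive_cc_MVT R f f1 r s rs.
  by move=> ?; apply: (profile_derive0 P); lra.
have c1 : f1 c < 0.
  rewrite -(pmulr_llt0 (x := s - r)) ?subr_gt0// -fc; lra.
have [d|d /andP[sd dt] fd] := @is_derive_cc_MVT R f f1 s t st.
  by move=> ?; apply: (profile_derive0 P); lra.
have d1 : 0 < f1 d.
  rewrite -(pmulr_lgt0 (x := t - s)) ?subr_gt0// -fd; lra.
have c0 : 0 < c by lra.
have cd : c < d by lra.
have [x|x /andP[x0 xc] fx] := @is_derive_cc_MVT R f1 f2 0 c c0.
  by move=> ?; apply: (profile_derive1 P); lra.
have x2 : f2 x < 0.
  rewrite -(pmulr_llt0 (x := c - 0)) ?subr_gt0// -fx (profile_at1 P); lra.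
have [y|y /andP[cy yd] fy] := @is_derive_cc_MVT R f1 f2 c d cd.
  by move=> ?; apply: (profile_derive1 P); lra.
have y2 : 0 < f2 y.
  rewrite -(pmulr_lgt0 (x := d - c)) ?subr_gt0// -fy; lra.
have xy : x < y by lra.
have [z|z /andP[xz zy] fz] := @is_derive_cc_MVT R f2 f3 x y xy.
  by move=> ?; apply: (profile_derive2 P); lra.
have /andP[_ z3] : - Lam <= f3 z <= - 1 by apply: (profile_bound3 P); lra.
nra.
Qed.

(** The upper bound theta t^2 - t^3 / 6 - mu must be nonnegative. This keeps the points of the
    spindle away from t = 0 and within depth 6 theta. *)
Lemma profile_support (R : realType) (theta mu Lam : R) (f f1 f2 f3 : R -> R) :
  0 < theta -> 0 < mu -> profile theta mu Lam f f1 f2 f3 ->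
  forall t : R, 0 <= t <= 2^-1 -> 0 <= f t -> mu <= theta * t ^+ 2 /\ 0 < t < 6 * theta.
Proof.
move=> th0 mu0 P t t01 ft0.
have /andP[_ ft] := profile_bound0 P t01.
have t0 : 0 < t.
  rewrite lt_neqAle; case/andP: (t01) => -> _; rewrite andbT eq_sym.
  by apply/eqP => tE; move: ft ft0; rewrite tE !expr0n/=; lra.
split; first nra.
rewrite t0/=.
have : 0 < t ^+ 2 * (6 * theta - t) by nra.
by rewrite pmulr_rgt0 ?exprn_gt0//; lra.
Qed.

(* (f1 ^+ 2 - 2 f f2)' = - 2 f f3 >= 0 where f >= 0. *)
Lemma profile_sqrt_concave (R : realType) (theta mu Lam : R) (f f1 f2 f3 : R -> R) :
  0 < theta -> 0 < mu -> 1 <= Lam -> theta <= 2^-1 ->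
  mu * Lam ^+ 2 <= theta ^+ 3 / 2 ->
  profile theta mu Lam f f1 f2 f3 ->
  forall t : R, 0 <= t <= 2^-1 -> 0 <= f t ->
  theta * mu <= f1 t ^+ 2 - 2 * f t * f2 t.
Proof.
move=> th0 mu0 L1 th2 muL P t t01 ft0.
have [_ /andP[t0 _]] := profile_support th0 mu0 P t01 ft0.
(* A zero [r] of [f] with r <= theta / Lam is wanted: there the lower bound on [f1] still gives f1 r
   >= theta * r, while theta * r^2 >= mu. The hypothesis on [mu] makes [f] nonnegative at theta /
   Lam, so that the intermediate value theorem applies on [0, T]. Between [r] and [t],
   quasi-concavity keeps f >= 0. *)
pose T := Num.min t (theta / Lam).
have L0 : 0 < Lam by lra.
have thL : 0 < theta / Lam <= theta.
  by rewrite divr_gt0//= ler_pdivrMr// ler_peMr// ltW.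
have Tt : T <= t by rewrite /T ge_min lexx.
have TL : T <= theta / Lam by rewrite /T ge_min lexx orbT.
have T0 : 0 < T by rewrite /T lt_min t0; case/andP: thL.
have fT : 0 <= f T.
  rewrite /T; case: (ltP t (theta / Lam)) => // _.
  have tL : 0 <= theta / Lam <= 2^-1 by lra.
  have /andP[lb _] := profile_bound0 P tL; apply: (le_trans _ lb).
  rewrite subr_ge0 -(ler_pM2r (x := Lam ^+ 2)) ?exprn_gt0//.
  apply: le_trans muL _.
  have -> : (theta * (theta / Lam) ^+ 2 - Lam * (theta / Lam) ^+ 3 / 6) * Lam ^+ 2
     = theta ^+ 3 * (5 / 6) by field; rewrite gt_eqF.
  have : 0 < theta ^+ 3 by rewrite exprn_gt0.
  lra.
have [||r] := @IVT R f 0 T 0 (ltW T0).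
- apply: derivable_within_continuous => x; rewrite in_itv/= => /andP[x0 xT].
  have x01 : 0 <= x <= 2^-1 by lra.
  by have [] := profile_derive0 P x01.
- rewrite (profile_at0 P) min_l; last lra.
  rewrite max_r; lra.
rewrite in_itv/= => /andP[r0 rT] fr.
have r01 : 0 <= r <= 2^-1 by lra.
have fr0 : 0 <= f r by rewrite fr.
have [mur /andP[r_gt0 _]] := profile_support th0 mu0 P r01 fr0.
have rt : r <= t by lra.
have Qr : f1 r ^+ 2 - 2 * f r * f2 r <= f1 t ^+ 2 - 2 * f t * f2 t.
  apply: (@ge0_derive_le R (fun t => f1 t ^+ 2 - 2 * f t * f2 t)
     (fun t => - 2 * f t * f3 t)) => // x /andP[rx xt].
  - have x01 : 0 <= x <= 2^-1 by lra.
    have d0 := profile_derive0 P x01.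
    have d1 := profile_derive1 P x01.
    have d2 := profile_derive2 P x01.
    by apply: is_derive_eq; rewrite /GRing.scale/=; ring.
  - have x01 : 0 <= x <= 2^-1 by lra.
    have fx : 0 <= f x.
      have := @profile_quasiconcave _ _ _ _ _ _ _ _ P r x t r0 rx xt.
      by move=> /(_ ltac:(lra)); apply: le_trans; rewrite le_min fr0.
    have /andP[_ x3] := profile_bound3 P x01.
    nra.
apply: le_trans Qr; rewrite fr.
have /andP[f1r _] := profile_bound1 P r01.
have Lr : Lam * r <= theta.
  by rewrite mulrC -ler_pdivlMr// (le_trans rT).
have : theta * r <= f1 r by apply: le_trans f1r; nra.
move=> f1r'.
have : (theta * r) ^+ 2 <= f1 r ^+ 2.
  have h0 : 0 <= theta * r by rewrite mulr_ge0// ltW.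
  by rewrite ler_pXn2r// nnegrE// (le_trans h0).
nra.
Qed.

(* E and e are the squared norm of the radial part and the axial part of a vector
   tangent to {s = f t}; the right-hand side of the conclusion is the Hessian of
   s - f t along this vector, and G is the norm of the gradient of s - f t. *)
Lemma profile_horoconvex (R : realType) (theta delta Lam : R) (f f1 f2 f3 : R -> R) :
  0 < theta -> 0 < delta -> 1 <= Lam -> 12 * theta <= 1 ->
  delta * Lam ^+ 2 <= 2^-1 -> 100 ^+ 4 * Lam ^+ 6 * theta <= delta ^+ 2 ->
  profile theta (delta * theta ^+ 3) Lam f f1 f2 f3 ->
  forall t : R, 0 <= t <= 2^-1 -> 0 <= f t ->
  forall G E e : R, 0 <= G -> G ^+ 2 = 4 * f t + f1 t ^+ 2 ->
  0 <= E -> 0 < E + e ^+ 2 -> f1 t ^+ 2 * e ^+ 2 <= 4 * f t * E ->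
  4 * G * (E + e ^+ 2) < 2 * E - f2 t * e ^+ 2.
Proof.
move=> th0 d0 L1 th12 dL thd P t t01 ft0 G E e G0 GE E0 Ee fE.
have mu0 : 0 < delta * theta ^+ 3 by rewrite mulr_gt0// exprn_gt0.
have [_ /andP[t0 t6]] := profile_support th0 mu0 P t01 ft0.
have Q : theta * (delta * theta ^+ 3) <= f1 t ^+ 2 - 2 * f t * f2 t.
  apply: (profile_sqrt_concave th0 mu0 L1 _ _ P) => //; first lra.
  have : 0 < theta ^+ 3 by rewrite exprn_gt0.
  nra.
have /andP[f1l f1u] := profile_bound1 P t01.
have /andP[_ fu] := profile_bound0 P t01.
have fb : f t <= 36 * theta ^+ 3.
  have : theta * t ^+ 2 <= theta * (6 * theta) ^+ 2.
    by rewrite ler_pM2l// ler_pXn2r// ?nnegrE; lra.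
  have : 0 <= t ^+ 3 by rewrite exprn_ge0// ltW.
  lra.
have t2 : t ^+ 2 <= 36 * theta ^+ 2.
  have -> : 36 * theta ^+ 2 = (6 * theta) ^+ 2 by ring.
  by rewrite ler_pXn2r// ?nnegrE; lra.
have f1b : f1 t ^+ 2 <= 900 * Lam ^+ 2 * theta ^+ 4.
  have -> : 900 * Lam ^+ 2 * theta ^+ 4 = (30 * Lam * theta ^+ 2) ^+ 2 by ring.
  have c0 : 0 <= 30 * Lam * theta ^+ 2.
    by rewrite mulr_ge0// ?exprn_ge0 ?mulr_ge0//; lra.
  rewrite -[f1 t ^+ 2]real_normK ?num_real// ler_pXn2r// ?nnegrE//.
  rewrite ler_norml; apply/andP; split; last first.
    apply: le_trans f1u _; have : theta * t <= theta * (6 * theta) by rewrite ler_pM2l// ltW.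
    have : theta ^+ 2 <= Lam * theta ^+ 2 by rewrite ler_peMl// exprn_ge0// ltW.
    have : 0 <= t ^+ 2 by rewrite exprn_ge0// ltW.
    have : 0 <= theta ^+ 2 by rewrite exprn_ge0// ltW.
    lra.
  apply: le_trans _ f1l; have : 0 <= theta * t by rewrite mulr_ge0// ltW.
  have : Lam * t ^+ 2 <= Lam * (36 * theta ^+ 2) by rewrite ler_pM2l//; lra.
  have : theta ^+ 2 <= Lam * theta ^+ 2 by rewrite ler_peMl// exprn_ge0// ltW.
  have : 0 <= theta ^+ 2 by rewrite exprn_ge0// ltW.
  lra.
have th3 : 0 < theta ^+ 3 by rewrite exprn_gt0.
have L0 : 0 < Lam by lra.
have L2 : 1 <= Lam ^+ 2 by rewrite exprn_ege1.
have f1b3 : f1 t ^+ 2 <= 75 * Lam ^+ 2 * theta ^+ 3.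
  apply: le_trans f1b _.
  have -> : 900 * Lam ^+ 2 * theta ^+ 4 = 75 * Lam ^+ 2 * theta ^+ 3 * (12 * theta) by ring.
  by rewrite ler_piMr// mulr_ge0 ?ltW// mulr_gt0//; lra.
have fb3 : f t <= 36 * Lam ^+ 2 * theta ^+ 3.
  apply: le_trans fb _; rewrite ler_pM2r//; lra.
have Gb : G ^+ 2 <= 219 * Lam ^+ 2 * theta ^+ 3 by lra.
have LG : 0 <= Lam ^+ 2 * G by rewrite mulr_ge0//; lra.
(* The place where theta must be small against delta^2: after squaring, Lam^6 theta^3 is compared
   with delta^2 theta^2. Here 219 = 4 * 36 + 75 comes from the bounds on f and f1^2 in [Gb], 438 = 2
   * 75 + 8 * 36 from the same bounds in [GQ], and 438^2 * 219 < 100^4. *)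
have LGd : 438 * (Lam ^+ 2 * G) < delta * theta.
  rewrite ltNge; apply/negP => H.
  have dt0 : 0 <= delta * theta by rewrite mulr_ge0// ltW.
  have LG2 : (Lam ^+ 2 * G) ^+ 2 <= 219 * (Lam ^+ 6 * theta ^+ 3).
    have -> : (Lam ^+ 2 * G) ^+ 2 = Lam ^+ 4 * G ^+ 2 by ring.
    have -> : 219 * (Lam ^+ 6 * theta ^+ 3) = Lam ^+ 4 * (219 * Lam ^+ 2 * theta ^+ 3) by ring.
    by apply: ler_wpM2l Gb; rewrite exprn_ge0// ltW.
  have dt2 : 100 ^+ 4 * (Lam ^+ 6 * theta ^+ 3) <= (delta * theta) ^+ 2.
    have -> : 100 ^+ 4 * (Lam ^+ 6 * theta ^+ 3) = 100 ^+ 4 * Lam ^+ 6 * theta * theta ^+ 2.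
      by ring.
    by rewrite exprMn; apply: ler_wpM2r thd; rewrite exprn_ge0// ltW.
  have H2 : (delta * theta) ^+ 2 <= 438 ^+ 2 * (Lam ^+ 2 * G) ^+ 2.
    have H0 := le_trans dt0 H.
    by rewrite -exprMn; apply: lerXn2r H; rewrite nnegrE; [exact: dt0|exact: H0].
  have L6 : 0 < Lam ^+ 6 * theta ^+ 3 by rewrite mulr_gt0// exprn_gt0//; lra.
  lra.
have dth : delta * theta < 1.
  have : delta <= 2^-1 by apply: le_trans dL; rewrite ler_peMr// ltW.
  nra.
have G8 : 8 * G < 1.
  have : G <= Lam ^+ 2 * G by rewrite ler_peMl.
  lra.
(* The left-hand side is the whole cost of asking for more than plain convexity; the margin [Q]
   absorbs it. *)
have GQ : 2 * G * f1 t ^+ 2 + 8 * f t * G < f1 t ^+ 2 - 2 * f t * f2 t.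
  apply: lt_le_trans Q.
  have : 2 * G * f1 t ^+ 2 + 8 * f t * G <= (438 * (Lam ^+ 2 * G)) * theta ^+ 3.
    have : G * f1 t ^+ 2 <= G * (75 * Lam ^+ 2 * theta ^+ 3) by rewrite ler_wpM2l.
    have : f t * G <= (36 * Lam ^+ 2 * theta ^+ 3) * G by rewrite ler_wpM2r.
    lra.
  move=> /le_lt_trans; apply.
  have -> : theta * (delta * theta ^+ 3) = (delta * theta) * theta ^+ 3 by ring.
  by rewrite ltr_pM2r.
rewrite ltNge; apply/negP => H.
have [e0|e0] := eqVneq e 0.
  by move: H Ee; rewrite e0 expr0n/= => H Ee; nra.
have e2 : 0 < e ^+ 2 by rewrite exprn_even_gt0.
(* Multiplying the negated goal by 4 f lets the tangency bound eliminate E; dividing by e^2 then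
   contradicts [GQ]. *)
have H1 : 4 * f t * ((2 - 4 * G) * E) <= 4 * f t * ((f2 t + 4 * G) * e ^+ 2).
  by rewrite ler_wpM2l ?mulr_ge0//; lra.
have H2 : (2 - 4 * G) * (f1 t ^+ 2 * e ^+ 2) <= (2 - 4 * G) * (4 * f t * E).
  by rewrite ler_wpM2l//; lra.
have : (2 - 4 * G) * f1 t ^+ 2 <= 4 * f t * (f2 t + 4 * G).
  by rewrite -(ler_pM2r e2); lra.
lra.
Qed.

(** The axis, parametrized by arc length s from the height 1, is y = exp (- s); so t = 1 - y equals
    s up to a relative error s. *)
Lemma onem_expRN_bounds (R : realType) (s : R) :
  0 <= s <= 1 -> s * (1 - s) <= 1 - expR (- s) <= s.
Proof.
move=> /andP[s0 s1]; apply/andP; split; last by have := expR_ge1Dx (- s); lra.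
have e0 := expR_gt0 (- s).
have : expR (- s) * (1 + s) <= 1.
  have e1 : expR (- s) * expR s = 1 by rewrite expRN mulVf// gt_eqF// expR_gt0.
  rewrite -[leRHS]e1.
  by rewrite ler_pM2l// expR_ge1Dx.
move=> h; have : expR (- s) <= 1 by rewrite -expR0 ler_expR oppr_le0.
nra.
Qed.

(** The term theta t^2 dominates at depths comparable with X theta: Lam * X <= om controls the cubic
    term, and the bound on [delta] controls the rounding, even at the near end om * X * theta / 2.
    The range is wider than the segment to be tested, because geodesics live on open intervals. *)
Lemma profile_vertex_gt0 (R : realType) (theta delta Lam om X : R) (f f1 f2 f3 : R -> R) :
  0 < theta -> 0 < om <= 8^-1 -> 0 < X <= 1 -> Lam * X <= om -> 0 < delta ->
  32 * delta < om ^+ 2 * X ^+ 2 -> theta <= om ->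
  profile theta (delta * theta ^+ 3) Lam f f1 f2 f3 ->
  forall s : R, om * (X * theta) / 2 < s < 2 * (X * theta) -> 0 < f (1 - expR (- s)).
Proof.
move=> th0 /andP[om0 om1] /andP[X0 X1] LX d0 dX thom P s /andP[s0 s1].
set S := X * theta in s0 s1.
have S0 : 0 < S by rewrite mulr_gt0.
have St : S <= theta by rewrite ler_piMl// ltW.
have omS : 0 < om * S by rewrite mulr_gt0.
have /onem_expRN_bounds : 0 <= s <= 1 by lra.
set t := 1 - expR _ => /andP[tl tu].
have ss : s * s <= 4^-1 * s by apply: ler_wpM2r; lra.
have ts : s / 2 <= t by lra.
have t01 : 0 <= t <= 2^-1 by lra.
have /andP[+ _] := profile_bound0 P t01; apply: lt_le_trans.
have tS : om * S / 4 <= t by lra.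
have t2 : om ^+ 2 * S ^+ 2 <= 16 * t ^+ 2.
  have : (om * S / 4) ^+ 2 <= t ^+ 2 by apply: lerXn2r tS; rewrite nnegrE; lra.
  lra.
have Lt : Lam * t <= 2 * om * theta.
  have [L0|L0] := leP Lam 0; first by have := mulr_gt0 om0 th0; nra.
  have : Lam * t <= Lam * (2 * S) by rewrite ler_pM2l//; lra.
  have : Lam * X * theta <= om * theta by rewrite ler_pM2r.
  rewrite /S; lra.
have th3 : 0 < theta ^+ 3 by rewrite exprn_gt0.
have H1 : Lam * t * t ^+ 2 <= 2 * om * theta * t ^+ 2.
  by apply: ler_wpM2r Lt; exact: sqr_ge0.
have H2 : om * (theta * t ^+ 2) <= 8^-1 * (theta * t ^+ 2).
  by apply: ler_wpM2r => //; rewrite mulr_ge0 ?sqr_ge0// ltW.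
have H3 : om ^+ 2 * X ^+ 2 * theta ^+ 3 <= 16 * (theta * t ^+ 2).
  have -> : om ^+ 2 * X ^+ 2 * theta ^+ 3 = theta * (om ^+ 2 * S ^+ 2) by rewrite /S; ring.
  by rewrite [leRHS]mulrCA ler_pM2l.
have H4 : 32 * delta * theta ^+ 3 < om ^+ 2 * X ^+ 2 * theta ^+ 3 by rewrite ltr_pM2r.
have -> : theta * t ^+ 2 - Lam * t ^+ 3 / 6 - delta * theta ^+ 3 =
  theta * t ^+ 2 - Lam * t * t ^+ 2 / 6 - delta * theta ^+ 3 by field.
have H5 : 0 < delta * theta ^+ 3 by rewrite mulr_gt0.
lra.
Qed.

(* Near its vertex f behaves like theta * t ^+ 2, so halving t divides it by
   almost 4, and 4 > 2 `^ (1 / alpha). *)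
Lemma profile_midpoint (R : realType) (theta delta Lam om X q c : R) (f f1 f2 f3 : R -> R) :
  0 < theta -> 24 * om <= 4 * q - 1 -> q <= 1 ->
  0 < om <= 8^-1 -> 0 < X <= 1 -> Lam * X <= om -> 0 < delta ->
  32 * delta < om ^+ 2 * X ^+ 2 -> theta <= om ->
  profile theta (delta * theta ^+ 3) Lam f f1 f2 f3 -> 1 - om <= c ->
  f (1 - expR (- ((1 + om) / 2 * (X * theta)))) < q * c * f (1 - expR (- (X * theta))).
Proof.
move=> th0 q4 q1 /andP[om0 om1] /andP[X0 X1] LX d0 dX thom P c1.
set S := X * theta.
have S0 : 0 < S by rewrite mulr_gt0.
have St : S <= theta by rewrite ler_piMl// ltW.
set s1 := (1 + om) / 2 * S.
have s1S : 0 <= s1 <= S by rewrite /s1; nra.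
have /onem_expRN_bounds : 0 <= s1 <= 1 by lra.
set t1 := 1 - expR _ => /andP[t1l t1u].
have /onem_expRN_bounds : 0 <= S <= 1 by lra.
set t2 := 1 - expR _ => /andP[t2l t2u].
have t1_0 : 0 <= t1 by apply: le_trans t1l; rewrite mulr_ge0//; lra.
have t2_0 : 0 <= t2 by apply: le_trans t2l; rewrite mulr_ge0//; lra.
have t1_01 : 0 <= t1 <= 2^-1 by lra.
have /andP[_ ft1] := profile_bound0 P t1_01.
have t2_01 : 0 <= t2 <= 2^-1 by lra.
have /andP[ft2 _] := profile_bound0 P t2_01.
have th3 : 0 < theta ^+ 3 by rewrite exprn_gt0.
have W0 : 0 < theta * S ^+ 2 by rewrite mulr_gt0// exprn_gt0.
(* The tested points are om * S and S, with midpoint (1 + om) / 2 * S; it suffices to bound [f] from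
   above at the midpoint and from below at the far end. *)
have ft1' : f t1 <= (1 + om) ^+ 2 / 4 * (theta * S ^+ 2).
  have -> : (1 + om) ^+ 2 / 4 * (theta * S ^+ 2) = theta * s1 ^+ 2 by rewrite /s1; field.
  have : theta * t1 ^+ 2 <= theta * s1 ^+ 2.
    by rewrite ler_pM2l//; apply: lerXn2r t1u; rewrite nnegrE; lra.
  have : 0 <= t1 ^+ 3 by rewrite exprn_ge0.
  have : 0 < delta * theta ^+ 3 by rewrite mulr_gt0.
  lra.
have ft2' : (1 - 4 * om) * (theta * S ^+ 2) <= f t2.
  apply: le_trans ft2.
  have H1 : (1 - 2 * om) * (theta * S ^+ 2) <= theta * t2 ^+ 2.
    rewrite [leLHS]mulrCA ler_pM2l//.
    have : (S * (1 - S)) ^+ 2 <= t2 ^+ 2.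
      by apply: lerXn2r t2l; rewrite nnegrE// mulr_ge0//; lra.
    apply: le_trans.
    have -> : (S * (1 - S)) ^+ 2 = (1 - S) ^+ 2 * S ^+ 2 by ring.
    rewrite ler_pM2r ?exprn_gt0//.
    by have := sqr_ge0 S; nra.
  have H2 : Lam * t2 ^+ 3 <= om * (theta * S ^+ 2).
    have [L0|L0] := leP Lam 0.
      have : 0 <= t2 ^+ 3 by rewrite exprn_ge0.
      have : 0 < om * (theta * S ^+ 2) by rewrite mulr_gt0.
      nra.
    have : Lam * t2 ^+ 3 <= Lam * S ^+ 3.
      by rewrite ler_pM2l//; apply: lerXn2r t2u; rewrite nnegrE; lra.
    move=> /le_trans; apply.
    have -> : Lam * S ^+ 3 = Lam * X * (theta * S ^+ 2) by rewrite /S; ring.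
    by rewrite ler_pM2r.
  have H3 : delta * theta ^+ 3 <= om * (theta * S ^+ 2).
    have -> : om * (theta * S ^+ 2) = om * X ^+ 2 * theta ^+ 3 by rewrite /S; ring.
    rewrite ler_pM2r//.
    have : om * (om * X ^+ 2) <= 1 * (om * X ^+ 2).
      by rewrite ler_wpM2r ?mulr_ge0 ?exprn_ge0 ?ltW//; lra.
    lra.
  have H4 : 0 < om * (theta * S ^+ 2) by rewrite mulr_gt0.
  lra.
apply: le_lt_trans ft1' _.
have q0 : 0 < q by lra.
have c0 : 0 < c by lra.
have : q * c * ((1 - 4 * om) * (theta * S ^+ 2)) <= q * c * f t2.
  by rewrite ler_pM2l// mulr_gt0.
apply: lt_le_trans; rewrite [ltRHS]mulrA ltr_pM2r//.
(* What remains is (1 + om)^2 / 4 < (1/4 + 6 om) (1 - om) (1 - 4 om): the gain 6 om in [q] outweighs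
   all the losses of first order in om. The factor [c] will be the quotient of the weights y^n at
   the two points. *)
have : (4^-1 + 6 * om) * (1 - om) <= q * c by apply: ler_pM; lra.
nra.
Qed.

(** * The explicit profile *)

(** This family is closed under differentiation and contains both y^-n and the logarithmic solution
    of the equation for F. *)
Definition log_power (R : realType) (p q : R) (n : nat) (y : R) : R :=
  (p + q * ln y) * y^-1 ^+ n.

Lemma is_derive_log_power (R : realType) (p q : R) (n : nat) (y : R) :
  0 < y ->
  is_derive y 1 (log_power p q n) (log_power (q - n%:R * p) (- (n%:R * q)) n.+1 y).
Proof.
move=> y0; have yN0 : y != 0 by rewrite gt_eqF.
have dln := is_derive1_ln y0.
have dV : is_derive y 1 (fun y : R => y^-1) (- y ^- 2 *: 1).
  exact: (@is_deriveV R id y 1 1 yN0 (is_derive_id y 1)).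
have dX := @is_deriveX R R (fun y : R => y^-1) n y 1 _ dV.
rewrite exprfctE in dX.
have dL : is_derive y 1 (fun y : R => p + q * ln y) (q * y^-1).
  by apply: is_derive_eq; rewrite /GRing.scale/=; ring.
have -> : log_power p q n = (fun y : R => p + q * ln y) * (fun y : R => y^-1 ^+ n) by [].
apply: is_derive_eq.
rewrite /GRing.scale/= /log_power.
case: n {dX} => [|n]; first by rewrite ?expr0 ?expr1; field.
by rewrite -!exprVn !exprS -pred_Sn; field.
Qed.

(* The solutions u = A y - B y * s of Delta u = -2 with B = b y ^+ k are
   u = b y ^+ k * (height y - s); the two remaining constants are chosen so that
   height 1 = - mu, height' 1 = 0 and height'' 1 = 2 theta. *)
Definition coefD (R : realType) (k : nat) (theta : R) : R :=
  4 * (k%:R + 1) / (k%:R * (k%:R + 2)) - 2 * theta / k%:R ^+ 2.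

Definition coefE (R : realType) (k : nat) (theta : R) : R := 2 - 2 * theta / k%:R.

(** The homogeneous equation y^2 F'' + (k + 1) y F' = 0 has the solutions 1 and y^-k. The quadratic
    term answers 2 k y^2; the right-hand side y^-k is resonant, whence the logarithm with
    coefficient [coefE]. *)
Definition height (R : realType) (k : nat) (theta mu y : R) : R :=
  k%:R / (k%:R + 2) * (y ^+ 2 - 1) - coefD k theta - mu +
  log_power (coefD k theta) (coefE k theta) k y.

Definition height1 (R : realType) (k : nat) (theta y : R) : R :=
  2 * k%:R / (k%:R + 2) * y +
  log_power (coefE k theta - k%:R * coefD k theta) (- (k%:R * coefE k theta)) k.+1 y.

Definition height2 (R : realType) (k : nat) (theta y : R) : R :=
  2 * k%:R / (k%:R + 2) +
  log_power (k%:R * (k%:R + 1) * coefD k theta - (2 * k%:R + 1) * coefE k theta)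
    (k%:R * (k%:R + 1) * coefE k theta) k.+2 y.

Definition height3 (R : realType) (k : nat) (theta y : R) : R :=
  log_power (2 * k%:R * (k%:R + 2) - (4 * k%:R + 6) * theta)
    (- (k%:R * (k%:R + 1) * (k%:R + 2) * coefE k theta)) k.+3 y.

Lemma is_derive_height (R : realType) (k : nat) (theta mu y : R) :
  0 < y -> is_derive y 1 (height k theta mu) (height1 k theta y).
Proof.
move=> y0; have d := is_derive_log_power (coefD k theta) (coefE k theta) k y0.
rewrite /height; apply: is_derive_eq; rewrite /GRing.scale/= /height1.
by rewrite -!addrA; congr (_ + _); ring.
Qed.

Lemma is_derive_height1 (R : realType) (k : nat) (theta y : R) :
  0 < y -> is_derive y 1 (height1 k theta) (height2 k theta y).
Proof.
move=> y0; have d := is_derive_log_power (coefE k theta - k%:R * coefD k theta)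
  (- (k%:R * coefE k theta)) k.+1 y0.
rewrite /height1; apply: is_derive_eq; rewrite /GRing.scale/= /height2.
by rewrite -!addrA; congr (_ + _); [ring | congr log_power; rewrite /coefE -?natr1; ring].
Qed.

Lemma is_derive_height2 (R : realType) (k : nat) (theta y : R) : (0 < k)%N ->
  0 < y -> is_derive y 1 (height2 k theta) (height3 k theta y).
Proof.
move=> k0 y0; have d := is_derive_log_power
  (k%:R * (k%:R + 1) * coefD k theta - (2 * k%:R + 1) * coefE k theta)
  (k%:R * (k%:R + 1) * coefE k theta) k.+2 y0.
rewrite /height2; apply: is_derive_eq; rewrite /GRing.scale/= /height3 add0r mul1r.
have kN0 : k%:R != 0 :> R by rewrite pnatr_eq0 -lt0n.
have k2N0 : k%:R + 2 != 0 :> R by rewrite -natrD pnatr_eq0 addn2.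
by congr log_power; rewrite /coefD /coefE -!natr1; [field; apply/andP | ring].
Qed.

(** The right-hand side is a multiple of y^-k, which the weight y^k of the torsion function cancels;
    normalizing the result to -2 forces b = 2 / (k * coefE). *)
Lemma height_pde (R : realType) (k : nat) (theta y : R) : 0 < y ->
  y ^+ 2 * height2 k theta y + (k%:R + 1) * (y * height1 k theta y) - 2 * k%:R * y ^+ 2 =
  - (k%:R * coefE k theta) * y^-1 ^+ k.
Proof.
move=> y0; have yN0 : y != 0 by rewrite gt_eqF.
have k2N0 : k%:R + 2 != 0 :> R by rewrite -natrD pnatr_eq0 addn2.
rewrite /height2 /height1 /log_power !exprS; field.
by rewrite ?yN0 ?k2N0.
Qed.

Lemma height_at1 (R : realType) (k : nat) (theta mu : R) : (0 < k)%N ->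
  [/\ height k theta mu 1 = - mu, height1 k theta 1 = 0 &
      height2 k theta 1 = 2 * theta].
Proof.
move=> k0; have kN0 : k%:R != 0 :> R by rewrite pnatr_eq0 -lt0n.
have k2N0 : k%:R + 2 != 0 :> R by rewrite -natrD pnatr_eq0 addn2.
rewrite /height /height1 /height2 /log_power ln1 invr1 !expr1n /coefD /coefE.
by split; field; rewrite ?kN0 ?k2N0.
Qed.

(** As 0 <= coefE <= 2 and -1 <= ln y, the numerator of [height3] is at most 2 k (k + 2) + 2 k (k +
    1) (k + 2) = 2 k (k + 2)^2, and y >= 1/2 bounds the power of 1 / y. *)
Definition height3_bound (R : realType) (k : nat) : R :=
  2 * k%:R * (k%:R + 2) ^+ 2 * 2 ^+ k.+3.

(** For y <= 1 the logarithmic term is nonnegative, so the lower bound comes from the constant part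
    alone, which is at least 1 for theta <= 1/4. *)
Lemma height3_bounds (R : realType) (k : nat) (theta y : R) : (0 < k)%N ->
  0 < theta <= 4^-1 -> 2^-1 <= y <= 1 ->
  1 <= height3 k theta y <= height3_bound R k.
Proof.
move=> k0 /andP[th0 th4] /andP[y2 y1].
have k1 : 1 <= k%:R :> R by rewrite ler1n.
have y0 : 0 < y by lra.
have E0 : 0 <= coefE k theta <= 2.
  have : 0 <= theta / k%:R <= theta by rewrite divr_ge0//= ?ler_piMr ?invf_le1; lra.
  rewrite /coefE; lra.
set p := 2 * k%:R * (k%:R + 2) - (4 * k%:R + 6) * theta.
have p1 : 1 <= p <= 2 * k%:R * (k%:R + 2) by rewrite /p; nra.
have lny : - 1 <= ln y <= 0.
  rewrite ln_le0// andbT -(expRK (- 1)) ler_ln ?posrE ?expR_gt0//.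
  rewrite expRN; apply: le_trans y2; rewrite lef_pV2 ?posrE ?expR_gt0//.
  by have := expR_ge1Dx (1 : R); lra.
have K0 : 0 <= k%:R * (k%:R + 1) * (k%:R + 2) :> R by rewrite !mulr_ge0//; lra.
have KE : 0 <= k%:R * (k%:R + 1) * (k%:R + 2) * coefE k theta <=
    2 * (k%:R * (k%:R + 1) * (k%:R + 2)).
  case/andP: E0 => E0 E2; rewrite mulr_ge0//= mulrC; exact: ler_wpM2r.
rewrite /height3 /log_power -/p.
have V1 : 1 <= y^-1 ^+ k.+3 by rewrite exprn_ege1// invf_ge1.
have V2 : y^-1 ^+ k.+3 <= 2 ^+ k.+3.
  apply: lerXn2r; rewrite ?nnegrE ?invr_ge0 ?ler0n ?(ltW y0)//.
  by rewrite -[leRHS]invrK lef_pV2 ?posrE//; lra.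
have /andP[L1 L2] : 0 <= - (k%:R * (k%:R + 1) * (k%:R + 2) * coefE k theta) * ln y
   <= 2 * (k%:R * (k%:R + 1) * (k%:R + 2)) by nra.
apply/andP; split.
  by rewrite -[leLHS]mulr1 ler_pM//; lra.
rewrite /height3_bound ler_pM//; [|by rewrite exprn_ge0// invr_ge0 ltW|]; first by lra.
have : 2 * k%:R * (k%:R + 2) ^+ 2 =
  2 * k%:R * (k%:R + 2) + 2 * (k%:R * (k%:R + 1) * (k%:R + 2)) :> R by ring.
move=> ->; lra.
Qed.

Lemma height3_bound_ge1 (R : realType) (k : nat) : (0 < k)%N -> 1 <= height3_bound R k.
Proof.
move=> k0; have k1 : 1 <= k%:R :> R by rewrite ler1n.
rewrite /height3_bound mulr_ege1//; last by rewrite exprn_ege1//; lra.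
by rewrite mulr_ege1//; [lra|rewrite exprn_ege1//; lra].
Qed.

Lemma profile_height (R : realType) (k : nat) (theta mu : R) : (0 < k)%N ->
  0 < theta <= 4^-1 ->
  profile theta mu (height3_bound R k) (fun t => height k theta mu (1 - t))
    (fun t => - height1 k theta (1 - t)) (fun t => height2 k theta (1 - t))
    (fun t => - height3 k theta (1 - t)).
Proof.
move=> k0 th0; have [h0 h1 h2] := height_at1 theta mu k0.
have d1 (t : R) : is_derive t 1 (fun t : R => 1 - t) (- 1).
  by apply: is_derive_eq; rewrite /GRing.scale/=; ring.
split => [t t01|t t01|t t01||||t t01].
- have y0 : 0 < 1 - t by lra.
  have dh := is_derive_height k theta mu y0.
  by have := @is_derive1_comp R _ (fun t : R => 1 - t) t _ _ dh (d1 t); rewrite mulrN1.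
- have y0 : 0 < 1 - t by lra.
  have dh := is_derive_height1 k theta y0.
  have := is_deriveN (@is_derive1_comp R _ (fun t : R => 1 - t) t _ _ dh (d1 t)).
  by rewrite mulrN1 opprK.
- have y0 : 0 < 1 - t by lra.
  have dh := is_derive_height2 theta k0 y0.
  by have := @is_derive1_comp R _ (fun t : R => 1 - t) t _ _ dh (d1 t); rewrite mulrN1.
- by rewrite subr0.
- by rewrite subr0 h1 oppr0.
- by rewrite subr0.
- have y0 : 2^-1 <= 1 - t <= 1 by lra.
  have := height3_bounds k0 th0 y0; lra.
Qed.

(** * Derivatives and smoothness in several variables *)

(** Write g = f + (g - f): the difference vanishes near [x], hence has differential 0 there. *)
Lemma near_eq_differentiable (R : realType) (V W : normedModType R) (f g : V -> W) (x : V) :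
  (\near x, f x = g x) -> differentiable f x -> differentiable g x.
Proof.
move=> fg df; have -> : g = f + (g - f) by rewrite addrC subrK.
suff dgf : differentiable (g - f) x by exact: differentiableD.
have z : (g - f) \o shift x = cst ((g - f) x) + (\0 : V -> W) +o_ 0 id.
  apply/eqaddoP => e e0; rewrite /= !fctE/= (nbhs_singleton fg) subrr.
  move: fg; rewrite (near_shift 0) subr0.
  apply: filterS => h /= fgh.
  by rewrite fgh !subrr addr0 subrr normr0 mulr_ge0// ltW.
have c0 : continuous (\0 : V -> W) by exact: cst_continuous.
by apply/diff_locallyP; rewrite (diff_unique (df := \0) c0 z).
Qed.

Lemma is_derive_coord (R : realType) (n : nat) (i : 'I_n) (x v : 'rV[R]_n) :
  is_derive x v (fun z : 'rV[R]_n => z 0 i) (v 0 i).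
Proof.
apply: DeriveDef; first exact/diff_derivable/differentiable_coord.
have := derive_mx (@derivable_id _ _ x v); rewrite derive_id.
by move=> /matrixP/(_ 0 i); rewrite mxE.
Qed.

Lemma differentiable_comp_coord (R : realType) (n : nat) (i : 'I_n) (f : R -> R)
    (x : 'rV[R]_n) :
  derivable f (x 0 i) 1 -> differentiable (fun z : 'rV[R]_n => f (z 0 i)) x.
Proof.
move=> df; apply: (@differentiable_comp _ _ _ _ (fun z : 'rV[R]_n => z 0 i) f).
  exact: differentiable_coord.
exact/derivable1_diffP.
Qed.

Lemma is_derive_comp_coord (R : realType) (n : nat) (i : 'I_n) (f : R -> R)
    (x v : 'rV[R]_n) (d : R) :
  is_derive (x 0 i) 1 f d -> is_derive x v (fun z : 'rV[R]_n => f (z 0 i)) (v 0 i * d).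
Proof.
move=> [df fd]; apply: DeriveDef.
  exact/diff_derivable/differentiable_comp_coord.
rewrite deriveE; last exact: differentiable_comp_coord.
rewrite (@diff_comp _ _ _ _ (fun z : 'rV[R]_n => z 0 i) f); last 2 first.
- exact: differentiable_coord.
- exact/derivable1_diffP.
have c := is_derive_coord i x v.
have cE : 'd (fun z : 'rV[R]_n => z 0 i) x v = v 0 i.
  by rewrite -deriveE ?derive_val//; exact: differentiable_coord.
by rewrite /= cE diff1E ?derive1E ?fd//; exact/derivable1_diffP.
Qed.

Lemma partialE (R : realType) (n : nat) (i : 'I_n) (f : 'rV[R]_n -> R) (x : 'rV[R]_n) (d : R) :
  is_derive x (delta_mx 0 i) f d -> partial i f x = d.
Proof. by move=> fd; rewrite /partial derive_val. Qed.

Lemma partial_ext (R : realType) (n : nat) (U : set 'rV[R]_n) (f g : 'rV[R]_n -> R) :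
  open U -> (forall x, U x -> f x = g x) ->
  forall i x, U x -> partial i f x = partial i g x.
Proof.
move=> oU fg i x Ux; apply: near_eq_derive.
have nU : nbhs x U by apply: open_nbhs_nbhs.
by apply: filterS nU => z /fg.
Qed.

(** The rules of differentiation identify partial derivatives only at points of [U]; openness is
    what lets such identities be differentiated again. *)
Lemma Ck_ext (R : realType) (n k : nat) (U : set 'rV[R]_n) (f g : 'rV[R]_n -> R) :
  open U -> (forall x, U x -> f x = g x) -> Ck k U f -> Ck k U g.
Proof.
move=> oU; elim: k f g => [|k IH] f g fg /=.
  move=> cf x Ux; change (g z @[z --> x] --> g x); rewrite -(fg _ Ux).
  have nU : nbhs x U by apply: open_nbhs_nbhs.
  have nfg : \near x, f x = g x by apply: filterS nU => z /fg.
  exact: cvg_trans (near_eq_cvg nfg) (cf x Ux).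
move=> [df cf]; split; last by move=> i; apply: IH (cf i) => x; exact: partial_ext.
move=> x Ux; apply: near_eq_differentiable (df x Ux).
have nU : nbhs x U by apply: open_nbhs_nbhs.
by apply: filterS nU => z /fg.
Qed.

Lemma CkS (R : realType) (n k : nat) (U : set 'rV[R]_n) (f : 'rV[R]_n -> R) :
  Ck k.+1 U f -> Ck k U f.
Proof.
elim: k f => [|k IH] f [df cf]; first by move=> x /df; exact: differentiable_continuous.
by split=> // i; apply: IH; exact: cf.
Qed.

Lemma CkW (R : realType) (n k : nat) (U V : set 'rV[R]_n) (f : 'rV[R]_n -> R) :
  V `<=` U -> Ck k U f -> Ck k V f.
Proof.
move=> VU; elim: k f => [|k IH] f; first by move=> cf x /VU; exact: cf.
by move=> [df cf]; split=> [x /VU|i]; [exact: df|exact: IH (cf i)].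
Qed.

Lemma Ck_cst (R : realType) (n k : nat) (U : set 'rV[R]_n) (c : R) :
  Ck k U (fun=> c).
Proof.
elim: k c => [|k IH] c; first by move=> x _; exact: cst_continuous.
split=> [x _|i]; first exact: differentiable_cst.
have -> : partial i (fun=> c) = fun=> 0 by apply/funext => x; exact: partialE.
exact: IH.
Qed.

Lemma CkD (R : realType) (n k : nat) (U : set 'rV[R]_n) (f g : 'rV[R]_n -> R) :
  open U -> Ck k U f -> Ck k U g -> Ck k U (fun x => f x + g x).
Proof.
move=> oU; elim: k f g => [|k IH] f g.
  by move=> cf cg x Ux; apply: continuousD; [exact: cf|exact: cg].
move=> [df cf] [dg cg]; split=> [x Ux|i].
  by apply: differentiableD; [exact: df|exact: dg].
apply: Ck_ext (IH _ _ (cf i) (cg i)) => // x Ux.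
by rewrite /partial deriveD//; apply: diff_derivable; [exact: df|exact: dg].
Qed.

Lemma CkM (R : realType) (n k : nat) (U : set 'rV[R]_n) (f g : 'rV[R]_n -> R) :
  open U -> Ck k U f -> Ck k U g -> Ck k U (fun x => f x * g x).
Proof.
move=> oU; elim: k f g => [|k IH] f g.
  by move=> cf cg x Ux; apply: continuousM; [exact: cf|exact: cg].
move=> Cf Cg; have [df cf] := Cf; have [dg cg] := Cg; split=> [x Ux|i].
  by apply: differentiableM; [exact: df|exact: dg].
apply: Ck_ext (CkD oU (IH _ _ (CkS Cf) (cg i)) (IH _ _ (CkS Cg) (cf i))) => // x Ux.
by rewrite /partial deriveM//; apply: diff_derivable; [exact: df|exact: dg].
Qed.

Lemma CkB (R : realType) (n k : nat) (U : set 'rV[R]_n) (f g : 'rV[R]_n -> R) :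
  open U -> Ck k U f -> Ck k U g -> Ck k U (fun x => f x - g x).
Proof.
move=> oU Cf Cg.
have -> : (fun x => f x - g x) = fun x => f x + (- 1) * g x.
  by apply/funext => x; rewrite mulN1r.
by apply: CkD => //; apply: CkM => //; exact: Ck_cst.
Qed.

Lemma CkX (R : realType) (n k p : nat) (U : set 'rV[R]_n) (f : 'rV[R]_n -> R) :
  open U -> Ck k U f -> Ck k U (fun x => f x ^+ p).
Proof.
move=> oU Cf; elim: p => [|p IH]; first exact: Ck_cst.
have -> : (fun x => f x ^+ p.+1) = (fun x => f x * f x ^+ p).
  by apply/funext => x; rewrite exprS.
exact: CkM.
Qed.

Lemma Ck_sum (R : realType) (n k : nat) (U : set 'rV[R]_n) (I : Type) (r : seq I)
    (P : pred I) (f : I -> 'rV[R]_n -> R) :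
  open U -> (forall i, Ck k U (f i)) -> Ck k U (fun x => \sum_(i <- r | P i) f i x).
Proof.
move=> oU Cf; elim: r => [|i r IH].
  have -> : (fun x => \sum_(i <- [::] | P i) f i x) = fun=> 0.
    by apply/funext => x; rewrite big_nil.
  exact: Ck_cst.
have -> : (fun x => \sum_(j <- i :: r | P j) f j x) =
    fun x => (if P i then f i x else 0) + \sum_(j <- r | P j) f j x.
  by apply/funext => x; rewrite big_cons; case: ifP; rewrite ?add0r.
by apply: CkD => //; case: (P i); [exact: Cf|exact: Ck_cst].
Qed.

Lemma Ck_coord (R : realType) (n k : nat) (U : set 'rV[R]_n) (i : 'I_n) :
  Ck k U (fun x => x 0 i).
Proof.
case: k => [|k]; first by move=> x _; exact/differentiable_continuous/differentiable_coord.
split=> [x _|j]; first exact: differentiable_coord.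
have -> : partial j (fun x : 'rV[R]_n => x 0 i) = fun=> (delta_mx 0 j : 'rV[R]_n) 0 i.
  by apply/funext => x; apply: partialE; exact: is_derive_coord.
exact: Ck_cst.
Qed.

Lemma is_derive_inv (R : realType) (y : R) :
  0 < y -> is_derive y 1 (@GRing.inv R) (- (y^-1 * y^-1)).
Proof.
move=> y0; have yN0 : y != 0 by rewrite gt_eqF.
have := @is_deriveV R id y 1 1 yN0 (is_derive_id y 1).
by rewrite /GRing.scale/= mulr1 -expr2 exprVn.
Qed.

(** The derivative of 1 / y is a constant multiple of the product of two copies of 1 / y, so that
    the induction closes through [CkM]. *)
Lemma Ck_coordV (R : realType) (n k : nat) (U : set 'rV[R]_n) (i : 'I_n) :
  open U -> (forall x, U x -> 0 < x 0 i) -> Ck k U (fun x => (x 0 i)^-1).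
Proof.
move=> oU U0.
have d x : U x -> differentiable (fun x : 'rV[R]_n => (x 0 i)^-1) x.
  move=> /U0 x0; apply: differentiable_comp_coord; have [] := is_derive_inv x0 => //.
elim: k => [|k IH]; first by move=> x /d; exact: differentiable_continuous.
split=> // j; pose c : R := - (delta_mx 0 j : 'rV[R]_n) 0 i.
apply: Ck_ext (CkM oU (Ck_cst k U c) (CkM oU IH IH)) => //.
move=> x /U0 x0; apply/esym/partialE.
by rewrite mulNr -mulrN; apply: is_derive_comp_coord; exact: is_derive_inv.
Qed.

Lemma Ck_coord_ln (R : realType) (n k : nat) (U : set 'rV[R]_n) (i : 'I_n) :
  open U -> (forall x, U x -> 0 < x 0 i) -> Ck k U (fun x => ln (x 0 i)).
Proof.
move=> oU U0.
have d x : U x -> differentiable (fun x : 'rV[R]_n => ln (x 0 i)) x.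
  by move=> /U0 x0; apply: differentiable_comp_coord; have [] := is_derive1_ln x0.
case: k => [|k]; first by move=> x /d; exact: differentiable_continuous.
split=> // j; pose c : R := (delta_mx 0 j : 'rV[R]_n) 0 i.
apply: Ck_ext (CkM oU (Ck_cst k U c) (Ck_coordV k oU U0)) => //.
move=> x /U0 x0; apply/esym/partialE.
by apply: is_derive_comp_coord; exact: is_derive1_ln.
Qed.

(** * The hyperbolic metric in coordinates *)

Lemma sum_delta_l (R : realType) (n : nat) (i : 'I_n) (a : 'I_n -> R) :
  \sum_(j < n) (i == j)%:R * a j = a i.
Proof.
rewrite (bigD1 i)//= eqxx mul1r big1 ?addr0// => j ji.
by rewrite eq_sym (negbTE ji) mul0r.
Qed.

Lemma sum_delta_r (R : realType) (n : nat) (i : 'I_n) (a : 'I_n -> R) :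
  \sum_(j < n) (j == i)%:R * a j = a i.
Proof. by rewrite -[RHS]sum_delta_l; apply: eq_bigr => j _; rewrite eq_sym. Qed.

Lemma inner_hyp (R : realType) (n : nat) (x v w : 'rV[R]_n.+1) :
  inner (hyp_metric R n) x v w = (x 0 ord_max) ^- 2 * \sum_i v 0 i * w 0 i.
Proof.
rewrite /inner /hyp_metric mul_mx_scalar -scalemxAl !mxE; congr (_ * _).
by apply: eq_bigr => i _; rewrite mxE.
Qed.

Lemma partial_hyp_metric (R : realType) (n : nat) (i j l : 'I_n.+1) (x : 'rV[R]_n.+1) :
  0 < x 0 ord_max ->
  partial i (fun y => hyp_metric R n y j l) x =
  (i == ord_max)%:R * (j == l)%:R * (- 2 * (x 0 ord_max)^-1 ^+ 3).
Proof.
move=> x0; apply: partialE.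
have -> : (fun y => hyp_metric R n y j l) =
    fun y => (fun t : R => (j == l)%:R * (t^-1 * t^-1)) (y 0 ord_max).
  by apply/funext => y; rewrite mxE -expr2 exprVn mulr_natl.
have d := is_derive_inv x0.
have f : is_derive (x 0 ord_max) 1 (fun t : R => (j == l)%:R * (t^-1 * t^-1))
    ((j == l)%:R * (- 2 * (x 0 ord_max)^-1 ^+ 3)).
  apply: (is_derive_eq (is_deriveZ (j == l)%:R (is_deriveM d d))).
  by rewrite /GRing.scale/=; ring.
rewrite -mulrA; have := is_derive_comp_coord (delta_mx 0 i) f; rewrite mxE eqxx/= (eq_sym ord_max).
by []. 
Qed.

Lemma christoffel_hyp (R : realType) (n : nat) (k i j : 'I_n.+1) (x : 'rV[R]_n.+1) :
  0 < x 0 ord_max ->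
  christoffel (hyp_metric R n) k i j x = - (x 0 ord_max)^-1 *
    ((i == ord_max)%:R * (j == k)%:R + (j == ord_max)%:R * (i == k)%:R
     - (k == ord_max)%:R * (i == j)%:R).
Proof.
move=> x0; have xN0 : x 0 ord_max != 0 by rewrite gt_eqF.
rewrite /christoffel.
have E l : invmx (hyp_metric R n x) k l = (k == l)%:R * x 0 ord_max ^+ 2.
  by rewrite invmx_scalar invrK mxE mulr_natl.
under eq_bigr => l _ do rewrite !partial_hyp_metric// E -[_ * _ ^+ 2 * _]mulrA.
by rewrite sum_delta_l; field.
Qed.

Lemma sum_christoffel_hyp (R : realType) (n : nat) (k : 'I_n.+1) (x : 'rV[R]_n.+1)
    (a b : 'I_n.+1 -> R) :
  0 < x 0 ord_max ->
  \sum_i \sum_j christoffel (hyp_metric R n) k i j x * a i * b j =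
  - (x 0 ord_max)^-1 *
    (a ord_max * b k + a k * b ord_max - (k == ord_max)%:R * \sum_i a i * b i).
Proof.
move=> x0.
have E i : \sum_j christoffel (hyp_metric R n) k i j x * a i * b j =
  - (x 0 ord_max)^-1 * ((i == ord_max)%:R * (a i * b k) + (i == k)%:R * (a i * b ord_max)
     - (k == ord_max)%:R * (a i * b i)).
  transitivity (\sum_j (- (x 0 ord_max)^-1 * ((i == ord_max)%:R * a i * ((j == k)%:R * b j)
     + (i == k)%:R * a i * ((j == ord_max)%:R * b j)
     - (k == ord_max)%:R * a i * ((i == j)%:R * b j)))).
    by apply: eq_bigr => j _; rewrite christoffel_hyp//; ring.
  rewrite -mulr_sumr sumrB big_split/= -!mulr_sumr !sum_delta_r sum_delta_l.
  by ring.
under eq_bigr => i _ do rewrite E.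
by rewrite -mulr_sumr sumrB big_split/= !sum_delta_r -mulr_sumr.
Qed.

(** The dimension is n + 1, so the first-order coefficient n - 1 is the dimension minus 2, as for
    any metric y^-2 |dx|^2. *)
Lemma laplacian_hyp (R : realType) (n : nat) (f : 'rV[R]_n.+1 -> R) (x : 'rV[R]_n.+1) :
  0 < x 0 ord_max ->
  laplacian (hyp_metric R n) f x =
  (x 0 ord_max) ^+ 2 * (\sum_i partial i (partial i f) x)
  - (n%:R - 1) * x 0 ord_max * partial ord_max f x.
Proof.
move=> x0; have xN0 : x 0 ord_max != 0 by rewrite gt_eqF.
rewrite /laplacian /hyp_metric invmx_scalar invrK mul_scalar_mx mxtraceZ.
have E i : hessian (hyp_metric R n) f x i i = partial i (partial i f) x
    + (x 0 ord_max)^-1 * (2 * ((i == ord_max)%:R * partial i f x) - partial ord_max f x).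
  rewrite mxE; congr (_ + _).
  transitivity (- \sum_k (- (x 0 ord_max)^-1 * (2 * (i == ord_max)%:R *
    ((i == k)%:R * partial k f x) - (k == ord_max)%:R * partial k f x))).
    by congr (- _); apply: eq_bigr => k _; rewrite christoffel_hyp// eqxx/=; ring.
  by rewrite -mulr_sumr sumrB/= -!mulr_sumr !sum_delta_r sum_delta_l; ring.
rewrite /mxtrace; under eq_bigr => i _ do rewrite E.
rewrite big_split/= -mulr_sumr sumrB/= -!mulr_sumr sum_delta_r sumr_const card_ord.
by rewrite -mulr_natl -natr1; field.
Qed.

(** Of the three Christoffel contributions, two cancel once both slots carry the same vector [e];
    only X_last |e|^2 survives. *)
Lemma inner_nabla_hyp (R : realType) (n : nat) (X : 'rV[R]_n.+1 -> 'rV[R]_n.+1)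
    (x e : 'rV[R]_n.+1) :
  0 < x 0 ord_max ->
  inner (hyp_metric R n) x (nabla (hyp_metric R n) e X x) e =
  (x 0 ord_max) ^- 2 * (\sum_i ('D_e X x) 0 i * e 0 i
    - (x 0 ord_max)^-1 * X x 0 ord_max * \sum_i e 0 i ^+ 2).
Proof.
move=> x0; rewrite inner_hyp; congr (_ * _).
transitivity (\sum_k (('D_e X x) 0 k * e 0 k - (x 0 ord_max)^-1 *
   (e 0 ord_max * (X x 0 k * e 0 k) + X x 0 ord_max * e 0 k ^+ 2
    - (\sum_i e 0 i * X x 0 i) * ((k == ord_max)%:R * e 0 k)))).
  apply: eq_bigr => k _; rewrite !mxE sum_christoffel_hyp//; ring.
rewrite sumrB -mulr_sumr sumrB big_split/= -!mulr_sumr sum_delta_r.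
have -> : \sum_i e 0 i * X x 0 i = \sum_i X x 0 i * e 0 i.
  by apply: eq_bigr => i _; rewrite mulrC.
by ring.
Qed.

Lemma geodesic_vertical (R : realType) (n : nat) (a b : R) :
  geodesic (hyp_space R n) (hyp_metric R n) a b
    (fun t => expR t *: (delta_mx 0 ord_max : 'rV[R]_n.+1)).
Proof.
set v : 'rV[R]_n.+1 := delta_mx 0 ord_max.
have de (t : R) i j : is_derive t 1 (fun s => (expR s *: v) i j) (expR t * v i j).
  rewrite (_ : (fun s => _) = fun s => expR s * v i j); last first.
    by apply/funext => s; rewrite mxE.
  by apply: is_derive_eq; rewrite /GRing.scale/=; ring.
have dv (t : R) : derivable (fun s => expR s *: v) t 1.
  by apply/derivable_mxP => i j; have [] := de t i j.
have d1 : derive1 (fun s => expR s *: v) = fun s => expR s *: v.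
  apply/funext => t; rewrite derive1E derive_mx//; apply/matrixP => i j.
  by rewrite mxE; have e := de t i j; rewrite derive_val [RHS]mxE.
move=> t _; rewrite !d1; split => // [|k].
  by rewrite /hyp_space/= !mxE !eqxx mulr1 expR_gt0.
have t0 := expR_gt0 t.
rewrite sum_christoffel_hyp ?mxE ?eqxx ?mulr1//.
have -> : \sum_i (expR t *: v) 0 i * (expR t *: v) 0 i = expR t ^+ 2.
  rewrite (bigD1 ord_max)//= big1 => [|i im]; first by rewrite addr0 !mxE !eqxx mulr1.
  by rewrite !mxE (negbTE im) !mulr0.
by field; rewrite gt_eqF.
Qed.

Lemma is_derive_bigsum (R : realType) (V : normedModType R) (I : Type) (r : seq I)
    (P : pred I) (f : I -> V -> R) (df : I -> R) (x v : V) :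
  (forall i, is_derive x v (f i) (df i)) ->
  is_derive x v (fun z => \sum_(i <- r | P i) f i z) (\sum_(i <- r | P i) df i).
Proof.
move=> fd; elim: r => [|i r IH].
  have -> : (fun z => \sum_(i <- [::] | P i) f i z) = fun=> 0.
    by apply/funext => z; rewrite big_nil.
  by rewrite big_nil; exact: is_derive_cst.
rewrite big_cons; case Pi : (P i).
  have -> : (fun z => \sum_(j <- i :: r | P j) f j z) =
      fun z => f i z + \sum_(j <- r | P j) f j z.
    by apply/funext => z; rewrite big_cons Pi.
  exact: is_deriveD.
have -> : (fun z => \sum_(j <- i :: r | P j) f j z) =
    fun z => \sum_(j <- r | P j) f j z by apply/funext => z; rewrite big_cons Pi.
exact: IH.
Qed.

Lemma unit_normal_hyp (R : realType) (n : nat) (rho : 'rV[R]_n.+1 -> R) (x : 'rV[R]_n.+1) :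
  0 < x 0 ord_max ->
  unit_normal (hyp_metric R n) rho x =
  (x 0 ord_max / Num.sqrt (\sum_i partial i rho x ^+ 2)) *: \row_i partial i rho x.
Proof.
move=> x0; rewrite /unit_normal.
have gE : gradient (hyp_metric R n) rho x = (x 0 ord_max) ^+ 2 *: \row_i partial i rho x.
  by rewrite /gradient invmx_scalar invrK mul_mx_scalar.
have nE : inner (hyp_metric R n) x (gradient (hyp_metric R n) rho x)
    (gradient (hyp_metric R n) rho x) =
    (x 0 ord_max) ^+ 2 * \sum_i partial i rho x ^+ 2.
  rewrite inner_hyp gE.
  have -> : \sum_i ((x 0 ord_max) ^+ 2 *: \row_i partial i rho x) 0 i *
      ((x 0 ord_max) ^+ 2 *: \row_i partial i rho x) 0 i =
      (x 0 ord_max) ^+ 4 * \sum_i partial i rho x ^+ 2.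
    by rewrite mulr_sumr; apply: eq_bigr => i _; rewrite !mxE; ring.
  by rewrite mulrA; congr (_ * _); field; rewrite gt_eqF.
rewrite nE gE scalerA; congr (_ *: _).
rewrite sqrtrM ?sqr_ge0// sqrtr_sqr ger0_norm ?ltW// invfM.
by move: (Num.sqrt _)^-1 => s; field; rewrite gt_eqF.
Qed.

(** Near [p] the unit normal is a scalar function times the Euclidean gradient of [rho]. The
    derivative of the scalar is paired with the gradient against the tangent vector [e] and drops
    out, leaving the Euclidean Hessian of [rho] and one connection term. *)
Lemma second_fundamental_form_hyp (R : realType) (n : nat) (rho : 'rV[R]_n.+1 -> R)
    (p e : 'rV[R]_n.+1) :
  0 < p 0 ord_max -> (forall i, differentiable (partial i rho) p) ->
  0 < \sum_i partial i rho p ^+ 2 -> \sum_i partial i rho p * e 0 i = 0 ->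
  second_fundamental_form (hyp_metric R n) rho p e e =
  (p 0 ord_max) ^- 2 *
    ((p 0 ord_max * (\sum_i 'D_e (partial i rho) p * e 0 i)
       - partial ord_max rho p * \sum_i e 0 i ^+ 2) /
     Num.sqrt (\sum_i partial i rho p ^+ 2)).
Proof.
move=> p0 dr W0 pe; rewrite /second_fundamental_form inner_nabla_hyp//.
pose W (z : 'rV[R]_n.+1) := \sum_i partial i rho z ^+ 2.
pose h (z : 'rV[R]_n.+1) := z 0 ord_max * (Num.sqrt (W z))^-1.
have dW : differentiable W p.
  rewrite /W.
  have -> : (fun z => \sum_i partial i rho z ^+ 2) =
      \sum_(i < n.+1) (fun z => partial i rho z ^+ 2) by rewrite fct_sumE.
  apply: differentiable_sum => i.
  have -> : (fun z => partial i rho z ^+ 2) = fun z => partial i rho z * partial i rho z.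
    by apply/funext => z; rewrite expr2.
  exact: differentiableM.
have sW0 : 0 < Num.sqrt (W p) by rewrite sqrtr_gt0.
have dh : differentiable h p.
  apply: (@differentiableM _ _ (fun z : 'rV[R]_n.+1 => z 0 ord_max) (fun z => (Num.sqrt (W z))^-1)).
    exact: differentiable_coord.
  apply: (@differentiable_comp _ _ _ _ W (fun t => (Num.sqrt t)^-1)) => //.
  apply/derivable1_diffP.
  have ds := is_derive1_sqrt W0.
  by have [] := @is_deriveV _ _ _ _ _ (lt0r_neq0 sW0) ds.
have dX i : is_derive p e (fun z => h z * partial i rho z)
   (h p * 'D_e (partial i rho) p + partial i rho p * 'D_e h p).
  by apply: is_deriveM; apply: derivableP; exact: diff_derivable.
have NE : \near p, \row_i (h p * partial i rho p) = unit_normal (hyp_metric R n) rho p.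
  have : \forall z \near p, 0 < (z : 'rV[R]_n.+1) 0 ord_max.
    have /differentiable_continuous c := differentiable_coord p 0 (ord_max : 'I_n.+1).
    exact: (cvgr_gt _ c).
  apply: filterS => z z0; rewrite unit_normal_hyp//.
  by apply/rowP => i; rewrite !mxE.
have DN i : ('D_e (unit_normal (hyp_metric R n) rho) p) 0 i =
    h p * 'D_e (partial i rho) p + partial i rho p * 'D_e h p.
  rewrite -(near_eq_derive _ NE) derive_mx; last first.
    apply/derivable_mxP => a b.
    rewrite (_ : (fun z => _) = fun z => h z * partial b rho z); last first.
      by apply/funext => z; rewrite mxE.
    by have [] := dX b.
  rewrite mxE (_ : (fun z => _) = fun z => h z * partial i rho z); last first.
    by apply/funext => z; rewrite mxE.
  by have d := dX i; rewrite derive_val.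
have -> : \sum_i ('D_e (unit_normal (hyp_metric R n) rho) p) 0 i * e 0 i =
    h p * \sum_i 'D_e (partial i rho) p * e 0 i.
  transitivity (\sum_i (h p * ('D_e (partial i rho) p * e 0 i) +
      (partial i rho p * e 0 i) * 'D_e h p)).
    by apply: eq_bigr => i _; rewrite DN; ring.
  by rewrite big_split/= -mulr_sumr -mulr_suml pe mul0r addr0.
rewrite unit_normal_hyp// !mxE -/(W p) /h; congr (_ * _).
by field; rewrite !gt_eqF.
Qed.

(** * Rotationally symmetric domains and their torsion functions *)

(** The [s] of the overview; throughout, [n] is one less than the dimension and plays the part of
    its [k]. *)
Definition axial (R : realType) (n : nat) (x : 'rV[R]_n.+1) : R :=
  \sum_(i | i != ord_max) x 0 i ^+ 2.

Definition spindle_fun (R : realType) (n : nat) (F : R -> R) (x : 'rV[R]_n.+1) : R :=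
  axial x - F (x 0 ord_max).

(** The weight B = y^n solves y^2 B'' = (n - 1) y B', which makes the coefficient of [axial x] in
    the Laplacian vanish and leaves an equation in y alone. *)
Definition torsion_fun (R : realType) (n : nat) (b : R) (F : R -> R) (x : 'rV[R]_n.+1) : R :=
  b * (x 0 ord_max) ^+ n * (F (x 0 ord_max) - axial x).

Lemma axial_ge0 (R : realType) (n : nat) (x : 'rV[R]_n.+1) : 0 <= axial x.
Proof. by apply: sumr_ge0 => i _; exact: sqr_ge0. Qed.

Lemma is_derive_axial (R : realType) (n : nat) (x v : 'rV[R]_n.+1) :
  is_derive x v (@axial R n) (\sum_(i | i != ord_max) 2 * x 0 i * v 0 i).
Proof.
apply: is_derive_bigsum => i; have d := is_derive_coord i x v.
have -> : (fun z : 'rV[R]_n.+1 => z 0 i ^+ 2) = fun z => z 0 i * z 0 i.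
  by apply/funext => z; rewrite expr2.
by apply: (is_derive_eq (is_deriveM d d)); rewrite /GRing.scale/=; ring.
Qed.

Lemma is_derive_spindle_fun (R : realType) (n : nat) (F : R -> R) (d : R)
    (x v : 'rV[R]_n.+1) :
  is_derive (x 0 ord_max) 1 F d ->
  is_derive x v (spindle_fun F)
    (\sum_(i | i != ord_max) 2 * x 0 i * v 0 i - v 0 ord_max * d).
Proof.
by move=> dF; apply: is_deriveB; [exact: is_derive_axial|exact: is_derive_comp_coord].
Qed.

Lemma sum_delta_mx (R : realType) (n : nat) (a : 'I_n -> R) (P : pred 'I_n) (i : 'I_n) :
  \sum_(j | P j) a j * (delta_mx 0 i : 'rV[R]_n) 0 j = if P i then a i else 0.
Proof.
rewrite big_mkcond (bigD1 i)//= big1 => [|j ji].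
  by rewrite mxE !eqxx mulr1 addr0.
by rewrite mxE (negbTE ji) andbF mulr0; case: ifP.
Qed.

Lemma partial_spindle_fun (R : realType) (n : nat) (F : R -> R) (d : R) (i : 'I_n.+1)
    (x : 'rV[R]_n.+1) :
  is_derive (x 0 ord_max) 1 F d ->
  partial i (spindle_fun F) x = if i == ord_max then - d else 2 * x 0 i.
Proof.
move=> dF; rewrite (partialE (is_derive_spindle_fun _ dF)) sum_delta_mx mxE eqxx/=.
by case: eqVneq => [->|im] /=; rewrite ?mul1r ?sub0r ?mul0r ?subr0.
Qed.

Lemma open_halfspace (R : realType) (n : nat) : open (hyp_space R n).
Proof.
have -> : hyp_space R n = (fun x : 'rV[R]_n.+1 => x 0 ord_max) @^-1` [set y | 0 < y] by [].
apply: open_comp; last exact: open_gt.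
by move=> x _; exact/differentiable_continuous/differentiable_coord.
Qed.

Lemma sum_ord_max (R : realType) (n : nat) (a : 'I_n.+1 -> R) :
  \sum_i a i = a ord_max + \sum_(i | i != ord_max) a i.
Proof. by rewrite (bigD1 ord_max). Qed.

Lemma sum_sq_partial_spindle_fun (R : realType) (n : nat) (F : R -> R) (d : R)
    (x : 'rV[R]_n.+1) :
  is_derive (x 0 ord_max) 1 F d ->
  \sum_i partial i (spindle_fun F) x ^+ 2 = 4 * axial x + d ^+ 2.
Proof.
move=> dF; rewrite sum_ord_max (partial_spindle_fun _ dF) eqxx sqrrN addrC; congr (_ + _).
rewrite /axial mulr_sumr; apply: eq_bigr => i im.
by rewrite (partial_spindle_fun _ dF) (negbTE im); ring.
Qed.

(** A (A B - S^2) is the sum of the squares of A b_i - S a_i; when A = 0, all the a_i vanish. *)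
Lemma cauchy_schwarz_sum (R : realType) (n : nat) (P : pred 'I_n) (a b : 'I_n -> R) :
  (\sum_(i | P i) a i * b i) ^+ 2 <=
  (\sum_(i | P i) a i ^+ 2) * (\sum_(i | P i) b i ^+ 2).
Proof.
set S := \sum_(i | P i) a i * b i; set A := \sum_(i | P i) a i ^+ 2.
set B := \sum_(i | P i) b i ^+ 2.
have A0 : 0 <= A by apply: sumr_ge0 => i _; exact: sqr_ge0.
have : 0 <= A * (A * B - S ^+ 2).
  have -> : A * (A * B - S ^+ 2) = \sum_(i | P i) (A * b i - S * a i) ^+ 2.
    transitivity (\sum_(i | P i) (A ^+ 2 * b i ^+ 2
        - (2 * A * S) * (a i * b i) + S ^+ 2 * a i ^+ 2)).
      rewrite big_split sumrB/= -!mulr_sumr -/A -/B -/S; ring.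
    by apply: eq_bigr => i _; ring.
  by apply: sumr_ge0 => i _; exact: sqr_ge0.
have [A00 _|AN0] := eqVneq A 0; last by rewrite pmulr_rge0 ?subr_ge0// lt_neqAle eq_sym AN0.
have /psumr_eq0P a0 : A = 0 := A00.
rewrite /S big1 ?expr0n ?mulr_ge0//; first by apply: sumr_ge0 => i _; exact: sqr_ge0.
move=> i Pi; have /eqP := a0 (fun i _ => sqr_ge0 (a i)) i Pi.
by rewrite sqrf_eq0 => /eqP ->; rewrite mul0r.
Qed.

(** With T = |e|^2 and Z the Hessian of s - F along [e], the claim reads G T < (y Z + F' T) / G * G
    / T * T, that is G T < y Z + F' T. Since |F'| <= G and y >= 1/2, it follows from 4 G T < Z. The
    tangency bound in the hypothesis is the Cauchy-Schwarz inequality applied to F' e_last = 2 sum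
    p_i e_i. *)
Lemma spindle_horoconvex_at (R : realType) (n : nat) (F F1 F2 : R -> R)
    (p e : 'rV[R]_n.+1) :
  (forall y : R, 0 < y -> is_derive y 1 F (F1 y)) ->
  (forall y : R, 0 < y -> is_derive y 1 F1 (F2 y)) ->
  2^-1 <= p 0 ord_max -> axial p = F (p 0 ord_max) ->
  0 < 4 * F (p 0 ord_max) + F1 (p 0 ord_max) ^+ 2 ->
  (forall G E a : R, 0 <= G ->
     G ^+ 2 = 4 * F (p 0 ord_max) + F1 (p 0 ord_max) ^+ 2 ->
     0 <= E -> 0 < E + a ^+ 2 ->
     F1 (p 0 ord_max) ^+ 2 * a ^+ 2 <= 4 * F (p 0 ord_max) * E ->
     4 * G * (E + a ^+ 2) < 2 * E - F2 (p 0 ord_max) * a ^+ 2) ->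
  inner (hyp_metric R n) p (unit_normal (hyp_metric R n) (spindle_fun F) p) e = 0 ->
  e != 0 ->
  inner (hyp_metric R n) p e e <
  second_fundamental_form (hyp_metric R n) (spindle_fun F) p e e.
Proof.
move=> dF dF1 p2; set y := p 0 ord_max => aF W0 HC.
have y0 : 0 < p 0 ord_max by rewrite (lt_le_trans _ p2)// invr_gt0.
have WE : \sum_i partial i (spindle_fun F) p ^+ 2 = 4 * F y + F1 y ^+ 2.
  by rewrite (sum_sq_partial_spindle_fun (dF _ y0)) aF.
pose psi (i : 'I_n.+1) (z : 'rV[R]_n.+1) := if i == ord_max then - F1 (z 0 ord_max) else 2 * z 0 i.
have psiE i z : hyp_space R n z -> psi i z = partial i (spindle_fun F) z.
  by move=> z0; rewrite (partial_spindle_fun _ (dF _ z0)).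
have npsi i : \near p, psi i p = partial i (spindle_fun F) p.
  have nU : nbhs p (hyp_space R n) by apply: open_nbhs_nbhs; split => //; exact: open_halfspace.
  by apply: filterS nU => z; exact: psiE.
have dpsi i : is_derive p e (psi i) (if i == ord_max then - (e 0 ord_max * F2 y) else 2 * e 0 i).
  rewrite /psi; case: eqVneq => _.
    exact: is_deriveN (is_derive_comp_coord _ (dF1 _ y0)).
  exact: (is_deriveZ 2 (is_derive_coord i p e)).
have diffpsi i : differentiable (partial i (spindle_fun F)) p.
  apply: near_eq_differentiable (npsi i) _; rewrite /psi; case: eqVneq => _.
    apply: differentiableN; apply: differentiable_comp_coord.
    by have [] := dF1 _ y0.
  by apply: (@differentiableZ _ _ _ (fun z : 'rV[R]_n.+1 => z 0 i)); exact: differentiable_coord.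
have DP i : 'D_e (partial i (spindle_fun F)) p =
    if i == ord_max then - (e 0 ord_max * F2 y) else 2 * e 0 i.
  by rewrite -(near_eq_derive _ (npsi i)); have d := dpsi i; rewrite derive_val.
rewrite unit_normal_hyp// inner_hyp => + eN0.
set G := Num.sqrt _.
have G0 : 0 < G by rewrite /G sqrtr_gt0 WE.
have G2 : G ^+ 2 = 4 * F y + F1 y ^+ 2 by rewrite /G sqr_sqrtr WE// ltW.
have -> : \sum_i ((p 0 ord_max / G) *: (\row_i partial i (spindle_fun F) p)) 0 i * e 0 i =
    (y / G) * \sum_i partial i (spindle_fun F) p * e 0 i.
  by rewrite mulr_sumr; apply: eq_bigr => i _; rewrite !mxE mulrA.
have c1 : 0 < p 0 ord_max ^- 2 by rewrite invr_gt0 exprn_gt0.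
have c2 : 0 < y / G by rewrite divr_gt0.
move=> H; have tan : \sum_i partial i (spindle_fun F) p * e 0 i = 0.
  by apply: (mulfI (lt0r_neq0 c2)); apply: (mulfI (lt0r_neq0 c1)); rewrite !mulr0.
rewrite second_fundamental_form_hyp// ?WE// -WE -/G inner_hyp.
rewrite ltr_pM2l ?invr_gt0 ?exprn_gt0//.
pose E := \sum_(i | i != ord_max) e 0 i ^+ 2.
have sE : \sum_i e 0 i * e 0 i = E + e 0 ord_max ^+ 2.
  by rewrite sum_ord_max -expr2 addrC; congr (_ + _); apply: eq_bigr => i _; rewrite expr2.
have sE' : \sum_i e 0 i ^+ 2 = E + e 0 ord_max ^+ 2.
  by rewrite -sE; apply: eq_bigr => i _; rewrite expr2.
have E0 : 0 <= E by apply: sumr_ge0 => i _; exact: sqr_ge0.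
have Ee : 0 < E + e 0 ord_max ^+ 2.
  rewrite -sE' lt_neqAle sumr_ge0 ?andbT => [|i _]; last exact: sqr_ge0.
  apply: contra eN0 => /eqP/esym/psumr_eq0P e0; apply/eqP/rowP => i.
  have /eqP := e0 (fun i _ => sqr_ge0 (e 0 i)) i isT.
  by rewrite sqrf_eq0 mxE => /eqP.
have tE : F1 y * e 0 ord_max = 2 * \sum_(i | i != ord_max) p 0 i * e 0 i.
  move: tan; rewrite sum_ord_max (partial_spindle_fun _ (dF _ y0)) eqxx mulNr addrC.
  move=> /eqP; rewrite subr_eq0 => /eqP <-; rewrite mulr_sumr; apply: eq_bigr => i im.
  by rewrite (partial_spindle_fun _ (dF _ y0)) (negbTE im) mulrA.
have cs : F1 y ^+ 2 * e 0 ord_max ^+ 2 <= 4 * F y * E.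
  rewrite -exprMn tE exprMn -aF -mulrA; apply: ler_pM => //; first exact: sqr_ge0.
    by rewrite -natrX.
  exact: cauchy_schwarz_sum.
have := HC G E (e 0 ord_max) (ltW G0) G2 E0 Ee cs.
have -> : \sum_i 'D_e (partial i (spindle_fun F)) p * e 0 i = 2 * E - F2 y * e 0 ord_max ^+ 2.
  rewrite sum_ord_max DP eqxx /E mulr_sumr addrC; congr (_ + _); last by ring.
  by apply: eq_bigr => i im; rewrite DP (negbTE im); ring.
rewrite sE ?sE' (partial_spindle_fun _ (dF _ y0)) eqxx ltr_pdivlMr// -/y.
set T := E + _ in Ee *; set Z := 2 * E - _ => HZ.
have F1G : - F1 y <= G.
  apply: (le_trans (ler_norm _)); rewrite normrN.
  rewrite -(ger0_norm (ltW G0)) -ler_sqr ?nnegrE// !real_normK ?num_real// G2.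
  by rewrite lerDr -aF mulr_ge0 ?axial_ge0.
have : (- F1 y) * T <= G * T by rewrite ler_pM2r.
have : 2^-1 * Z <= y * Z.
  by rewrite ler_wpM2r//; apply: le_trans (ltW HZ); rewrite !mulr_ge0// ltW.
lra.
Qed.

Lemma Ck_height (R : realType) (n j k : nat) (theta mu : R) :
  Ck j (hyp_space R n) (fun x => height k theta mu (x 0 ord_max)).
Proof.
have oU := @open_halfspace R n.
have U0 x : hyp_space R n x -> 0 < x 0 ord_max by [].
have CV := Ck_coordV j oU U0; have CL := Ck_coord_ln j oU U0.
have CX := Ck_coord j (hyp_space R n) (ord_max : 'I_n.+1).
have Cc := @Ck_cst R n.+1 j (hyp_space R n).
rewrite /height /log_power.
apply: CkD => //.
  apply: CkD => //; apply: CkD => //; apply: CkM => //; apply: CkD => //; exact: CkX.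
apply: CkM => //; last exact: CkX.
by apply: CkD => //; exact: CkM.
Qed.

Lemma Ck_axial (R : realType) (n j : nat) : Ck j (hyp_space R n) (@axial R n).
Proof.
have oU := @open_halfspace R n.
by apply: Ck_sum => // i; apply: CkX => //; exact: Ck_coord.
Qed.

Lemma Ck_spindle_fun (R : realType) (n j k : nat) (theta mu : R) :
  Ck j (hyp_space R n) (spindle_fun (height k theta mu)).
Proof.
have oU := @open_halfspace R n.
by apply: CkB => //; [exact: Ck_axial|exact: Ck_height].
Qed.

Lemma Ck_torsion_fun (R : realType) (n j k : nat) (b theta mu : R) :
  Ck j (hyp_space R n) (torsion_fun b (height k theta mu)).
Proof.
have oU := @open_halfspace R n.
apply: CkM => //; last by apply: CkB => //; [exact: Ck_height|exact: Ck_axial].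
by apply: CkM => //; [exact: Ck_cst|apply: CkX => //; exact: Ck_coord].
Qed.

Lemma is_derive_exprn (R : realType) (n : nat) (y : R) :
  is_derive y 1 (fun t : R => t ^+ n) (n%:R * y ^+ n.-1).
Proof.
apply: DeriveDef; first exact: exprn_derivable.
by rewrite exp_derive /GRing.scale/= mulr1.
Qed.

Lemma is_derive_torsion_fun (R : realType) (n : nat) (b d : R) (F : R -> R)
    (x v : 'rV[R]_n.+1) :
  is_derive (x 0 ord_max) 1 F d ->
  is_derive x v (torsion_fun b F)
    (b * (v 0 ord_max * (n%:R * x 0 ord_max ^+ n.-1)) * (F (x 0 ord_max) - axial x)
     + b * x 0 ord_max ^+ n *
       (v 0 ord_max * d - \sum_(i | i != ord_max) 2 * x 0 i * v 0 i)).
Proof.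
move=> dF.
have d1 := is_deriveZ b (is_derive_comp_coord v (is_derive_exprn n (x 0 ord_max))).
have d2 := is_deriveB (is_derive_comp_coord v dF) (is_derive_axial x v).
apply: (is_derive_eq (is_deriveM d1 d2)).
by rewrite /GRing.scale/= !fctE /GRing.scale/=; ring.
Qed.

Lemma partial_torsion_fun (R : realType) (n : nat) (b d : R) (F : R -> R) (i : 'I_n.+1)
    (x : 'rV[R]_n.+1) :
  is_derive (x 0 ord_max) 1 F d ->
  partial i (torsion_fun b F) x =
  if i == ord_max then
    b * (n%:R * x 0 ord_max ^+ n.-1) * (F (x 0 ord_max) - axial x)
      + b * x 0 ord_max ^+ n * d
  else - (2 * b * x 0 ord_max ^+ n * x 0 i).
Proof.
move=> dF; rewrite (partialE (is_derive_torsion_fun _ _ dF)) sum_delta_mx mxE eqxx/=.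
by case: eqVneq => [->|im] /=; ring.
Qed.

Lemma laplacian_torsion_fun (R : realType) (n : nat) (b : R) (F F1 F2 : R -> R)
    (x : 'rV[R]_n.+1) : (0 < n)%N ->
  (forall y : R, 0 < y -> is_derive y 1 F (F1 y)) ->
  (forall y : R, 0 < y -> is_derive y 1 F1 (F2 y)) ->
  0 < x 0 ord_max ->
  laplacian (hyp_metric R n) (torsion_fun b F) x =
  b * x 0 ord_max ^+ n * (x 0 ord_max ^+ 2 * F2 (x 0 ord_max)
    + (n%:R + 1) * (x 0 ord_max * F1 (x 0 ord_max)) - 2 * n%:R * x 0 ord_max ^+ 2).
Proof.
move=> n0 dF dF1 x0; set y := x 0 ord_max in x0 *.
have oU := @open_halfspace R n.
have Ux : hyp_space R n x by [].
have P2 i : partial i (partial i (torsion_fun b F)) x =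
    if i == ord_max then
      b * (n%:R * (n.-1%:R * y ^+ n.-2)) * (F y - axial x)
       + 2 * b * (n%:R * y ^+ n.-1) * F1 y + b * y ^+ n * F2 y
    else - (2 * b * y ^+ n).
  have /= E z : hyp_space R n z -> _ = _ := fun z0 => partial_torsion_fun b i (dF (z 0 ord_max) z0).
  case: eqVneq => [iE|im].
    rewrite iE eqxx in E *.
    rewrite (partial_ext oU E)//; apply: partialE.
    have v1 : (delta_mx 0 ord_max : 'rV[R]_n.+1) 0 ord_max = 1 by rewrite mxE !eqxx.
    have d1 := is_derive_comp_coord (delta_mx 0 ord_max) (is_derive_exprn n y).
    have d2 := is_derive_comp_coord (delta_mx 0 ord_max) (is_derive_exprn n.-1 y).
    have d3 := is_deriveB (is_derive_comp_coord (delta_mx 0 ord_max) (dF _ x0))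
       (is_derive_axial x (delta_mx 0 ord_max)).
    have d4 := is_derive_comp_coord (delta_mx 0 ord_max) (dF1 _ x0).
    apply: (is_derive_eq (is_deriveD (is_deriveM (is_deriveZ b (is_deriveZ n%:R d2)) d3)
       (is_deriveM (is_deriveZ b d1) d4))).
    by rewrite sum_delta_mx eqxx/= !v1 /GRing.scale/= !fctE /GRing.scale/= -/y; ring.
  rewrite (negbTE im) in E.
  rewrite (partial_ext oU E)//; apply: partialE.
  have d1 := is_derive_comp_coord (delta_mx 0 i) (is_derive_exprn n y).
  have d2 := is_derive_coord i x (delta_mx 0 i).
  apply: (is_derive_eq (is_deriveN (is_deriveM (is_deriveZ (2 * b) d1) d2))).
  have v0 : (delta_mx 0 i : 'rV[R]_n.+1) 0 ord_max = 0.
    by rewrite mxE eqxx eq_sym (negbTE im).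
  have v1 : (delta_mx 0 i : 'rV[R]_n.+1) 0 i = 1 by rewrite mxE !eqxx.
  by rewrite v0 v1 /GRing.scale/= /GRing.scale/= -/y; ring.
rewrite laplacian_hyp// sum_ord_max P2 eqxx.
under eq_bigr => i im do rewrite P2 (negbTE im).
rewrite sumr_const (partial_torsion_fun b _ (dF _ x0)) eqxx -/y.
have -> : #|[pred i : 'I_n.+1 | i != ord_max]| = n.
  by have := cardC1 (ord_max : 'I_n.+1); rewrite card_ord.
rewrite -mulr_natl.
have E1 : y * (n%:R * y ^+ n.-1) = n%:R * y ^+ n.
  have -> : y ^+ n = y * y ^+ n.-1 by rewrite -exprS prednK.
  by ring.
(* For n = 1 the truncated exponent [n.-2] does no harm, as the factor [n.-1] is then 0. By [E1] and
   [E2] the terms in F - s cancel: n (n - 1) - (n - 1) n = 0. *)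
have E2 : y ^+ 2 * (n%:R * (n.-1%:R * y ^+ n.-2)) = n%:R * (n%:R - 1) * y ^+ n.
  move: (y) => z; case: (n) n0 => // -[|k] _ /=; first by rewrite subrr mulr0 !mul0r !mulr0.
  by rewrite !exprS -!natr1; ring.
transitivity (b * (F y - axial x) * (y ^+ 2 * (n%:R * (n.-1%:R * y ^+ n.-2))
    - (n%:R - 1) * (y * (n%:R * y ^+ n.-1)))
  + 2 * b * F1 y * y * (y * (n%:R * y ^+ n.-1)) + y ^+ 2 * (b * y ^+ n * F2 y)
  - 2 * n%:R * b * y ^+ 2 * y ^+ n - (n%:R - 1) * y * (b * y ^+ n * F1 y)); first by ring.
by rewrite E2 E1; ring.
Qed.

Lemma laplacian_torsion_height (R : realType) (n : nat) (theta mu : R) (x : 'rV[R]_n.+1) :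
  (0 < n)%N -> coefE n theta != 0 -> 0 < x 0 ord_max ->
  laplacian (hyp_metric R n) (torsion_fun (2 / (n%:R * coefE n theta)) (height n theta mu)) x
    = - 2.
Proof.
move=> n0 E0 x0.
have nN0 : n%:R != 0 :> R by rewrite pnatr_eq0 -lt0n.
rewrite (laplacian_torsion_fun _ n0 (is_derive_height n theta mu) (is_derive_height1 n theta) x0).
rewrite height_pde// exprVn; field.
by apply/and3P; split => //; rewrite expf_neq0// gt_eqF.
Qed.

(** * Topology and smoothness of the spindle *)

Definition spindle (R : realType) (n : nat) (F : R -> R) : set 'rV[R]_n.+1 :=
  [set x : 'rV[R]_n.+1 | 2^-1 < x 0 ord_max < 1 /\ spindle_fun F x < 0].
Arguments spindle {R} n F.

Lemma closure_le0 (R : realType) (T : topologicalType) (A : set T) (p : T) (f : T -> R) :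
  closure A p -> {for p, continuous f} -> (forall x, A x -> f x <= 0) -> f p <= 0.
Proof.
move=> Ap cf fA; rewrite leNgt; apply/negP => fp.
have nf : \forall z \near p, 0 < f z by apply: (cvgr_gt (f p)).
by have [z [/fA]] := Ap _ nf; rewrite leNgt => /negP.
Qed.

Lemma continuous_last (R : realType) (n : nat) (p : 'rV[R]_n.+1) :
  {for p, continuous (fun x : 'rV[R]_n.+1 => x 0 ord_max)}.
Proof. exact/differentiable_continuous/differentiable_coord. Qed.

Lemma spindle_height (R : realType) (n : nat) (theta mu : R) (x : 'rV[R]_n.+1) :
  (0 < n)%N -> 0 < theta -> 12 * theta < 1 -> 0 < mu ->
  2^-1 <= x 0 ord_max <= 1 -> spindle_fun (height n theta mu) x <= 0 ->
  [/\ mu <= theta * (1 - x 0 ord_max) ^+ 2, 0 < 1 - x 0 ord_max < 6 * theta &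
      axial x <= height n theta mu (x 0 ord_max)].
Proof.
move=> n0 th0 th12 mu0 x01; rewrite subr_le0 => aF.
have P : profile theta mu _ _ _ _ _ := profile_height mu n0 (ltac:(lra) : 0 < theta <= 4^-1).
have t01 : 0 <= 1 - x 0 ord_max <= 2^-1 by lra.
have := profile_support th0 mu0 P t01; rewrite subKr => /(_ (le_trans (axial_ge0 x) aF)).
by case.
Qed.

Lemma continuous_spindle_fun (R : realType) (n k : nat) (theta mu : R) (p : 'rV[R]_n.+1) :
  0 < p 0 ord_max -> {for p, continuous (spindle_fun (height k theta mu))}.
Proof. exact: (@Ck_spindle_fun R n 0 k theta mu p). Qed.

(** The band 1/2 < y < 1 is there because F is positive again for large y and the profile is
    controlled only for y >= 1/2. Its faces create no boundary: a point of the closure has 0 < 1 - y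
    < 6 theta < 1/2, so the strict inequalities survive. *)
Lemma closure_spindle (R : realType) (n : nat) (theta mu : R) (p : 'rV[R]_n.+1) :
  (0 < n)%N -> 0 < theta -> 12 * theta < 1 -> 0 < mu ->
  closure (spindle n (height n theta mu)) p ->
  2^-1 < p 0 ord_max < 1 /\ spindle_fun (height n theta mu) p <= 0.
Proof.
move=> n0 th0 th12 mu0 cp.
have p2 : 2^-1 - p 0 ord_max <= 0.
  apply: (closure_le0 (f := fun x : 'rV[R]_n.+1 => 2^-1 - x 0 ord_max) cp) => [|x [xb _]].
    by apply: continuousB; [exact: cst_continuous|exact: continuous_last].
  lra.
have p1 : p 0 ord_max - 1 <= 0.
  apply: (closure_le0 (f := fun x : 'rV[R]_n.+1 => x 0 ord_max - 1) cp) => [|x [xb _]].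
    by apply: continuousB; [exact: continuous_last|exact: cst_continuous].
  lra.
have pr : spindle_fun (height n theta mu) p <= 0.
  apply: (closure_le0 cp) => [|x [_ /ltW]//].
  by apply: continuous_spindle_fun; lra.
have pb : 2^-1 <= p 0 ord_max <= 1 by lra.
have [_ t6 _] := spindle_height n0 th0 th12 mu0 pb pr.
by split=> //; lra.
Qed.

Lemma open_spindle (R : realType) (n : nat) (theta mu : R) :
  open (spindle n (height n theta mu)).
Proof.
rewrite openE => p [/andP[p2 p1] pr]; rewrite /interior.
have c := @continuous_last R n p.
have p0 : 0 < p 0 ord_max by lra.
have n2 : \forall z \near p, 2^-1 < (z : 'rV[R]_n.+1) 0 ord_max.
  exact: (cvgr_gt _ c).
have n1 : \forall z \near p, (z : 'rV[R]_n.+1) 0 ord_max < 1.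
  exact: (cvgr_lt _ c).
have nr : \forall z \near p, spindle_fun (height n theta mu) z < 0.
  have cr : {for p, continuous (spindle_fun (height n theta mu))}.
    exact: continuous_spindle_fun.
  exact: (cvgr_lt _ cr).
by apply: filterS3 n2 n1 nr => z z2 z1 zr; split => //; rewrite z2 z1.
Qed.

Lemma boundary_spindle (R : realType) (n : nat) (theta mu : R) (p : 'rV[R]_n.+1) :
  (0 < n)%N -> 0 < theta -> 12 * theta < 1 -> 0 < mu ->
  boundary (hyp_space R n) (spindle n (height n theta mu)) p ->
  2^-1 < p 0 ord_max < 1 /\ axial p = height n theta mu (p 0 ord_max).
Proof.
move=> n0 th0 th12 mu0 [_ [cp ip]].
have [pb pr] := closure_spindle n0 th0 th12 mu0 cp.
split=> //; apply/eqP; rewrite -subr_eq0 eq_le -/(spindle_fun _ _) pr/= leNgt.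
apply/negP => pr0; apply: ip.
by apply: open_nbhs_nbhs; split; [exact: open_spindle|split].
Qed.

Lemma connected_segment (R : realType) (n : nat) (v w : 'rV[R]_n) (A : set R) :
  is_interval A -> connected ((fun s : R => s *: v + w) @` A).
Proof.
move=> /connected_intervalP cA; apply: connected_continuous_connected => //.
apply: continuous_subspaceT => s.
apply: (@cvgD _ _ _ _ _ (fun s : R => s *: v) (cst w)); first exact: scalel_continuous.
exact: cvg_cst.
Qed.

(** Each point is joined to the axis by a horizontal segment inside the spindle, and the part of the
    axis in the spindle is an interval by quasi-concavity of F. *)
Lemma connected_spindle (R : realType) (n : nat) (theta mu : R) :
  (0 < n)%N -> 0 < theta -> 12 * theta < 1 -> 0 < mu ->
  (exists2 y, 2^-1 < y < 1 & 0 < height n theta mu y) ->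
  connected (spindle n (height n theta mu)).
Proof.
move=> n0 th0 th12 mu0 [y0 y01 Fy0].
have P : profile theta mu _ _ _ _ _ := profile_height mu n0 (ltac:(lra) : 0 < theta <= 4^-1).
set F := height n theta mu in Fy0 P *.
pose J := [set y : R | 2^-1 < y < 1 /\ 0 < F y].
have iJ : is_interval J.
  move=> a b [/andP[a2 a1] Fa] [/andP[b2 b1] Fb] c /andP[ac cb]; split; first lra.
  have := @profile_quasiconcave _ _ _ _ _ _ _ _ P (1 - b) (1 - c) (1 - a).
  rewrite !subKr => /(_ ltac:(lra) ltac:(lra) ltac:(lra) ltac:(lra)).
  by apply: lt_le_trans; rewrite lt_min Fa Fb.
pose v : 'rV[R]_n.+1 := delta_mx 0 ord_max.
pose L := (fun s : R => s *: v + 0) @` J.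
pose S (x : 'rV[R]_n.+1) :=
  (fun s : R => s *: (x - x 0 ord_max *: v) + x 0 ord_max *: v) @` [set s | 0 <= s <= 1].
have axv (y : R) : axial (y *: v) = 0.
  by apply: big1 => i im; rewrite !mxE (negbTE im) andbF mulr0 expr0n.
have lv (y : R) : (y *: v) 0 ord_max = y by rewrite !mxE !eqxx mulr1.
have xJ x : spindle n F x -> J (x 0 ord_max).
  by move=> [xb]; rewrite subr_lt0 => /(le_lt_trans (axial_ge0 x)) F0; split.
have lS (x : 'rV[R]_n.+1) (s : R) :
    (s *: (x - x 0 ord_max *: v) + x 0 ord_max *: v) 0 ord_max = x 0 ord_max.
  by rewrite !mxE !eqxx /=; ring.
have aS (x : 'rV[R]_n.+1) (s : R) :
    axial (s *: (x - x 0 ord_max *: v) + x 0 ord_max *: v) = s ^+ 2 * axial x.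
  rewrite /axial mulr_sumr; apply: eq_bigr => i im; rewrite !mxE (negbTE im) andbF.
  by rewrite /=; ring.
have -> : spindle n F = \bigcup_(x in spindle n F) (S x `|` L).
  apply/seteqP; split=> [x xO|z [x xO]].
    exists x => //; left; exists 1; first by rewrite /= ler01 lexx.
    by rewrite scale1r subrK.
  have [xb] := xO; rewrite subr_lt0 => xF.
  case=> [[s /andP[s0 s1] <-]|[y [yb Fy] <-]].
    split; rewrite ?lS// /spindle_fun lS aS subr_lt0 (le_lt_trans _ xF)//.
    by rewrite ler_piMl ?axial_ge0// expr_le1.
  by split; rewrite addr0 ?lv// /spindle_fun axv lv sub0r oppr_lt0.
apply: bigcup_connected => [|x xO].
  by exists (y0 *: v) => x xO; right; exists y0; [split|rewrite addr0].
apply: connectedU.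
- exists (x 0 ord_max *: v); split.
    by exists 0; [rewrite /= lexx ler01|rewrite scale0r add0r].
  by exists (x 0 ord_max); [exact: xJ|rewrite addr0].
- apply: connected_segment => a b /= /andP[a0 a1] /andP[b0 b1] c /andP[ac cb].
  by rewrite (le_trans a0 ac) (le_trans cb b1).
- exact: connected_segment.
Qed.

Lemma domain_spindle (R : realType) (n : nat) (theta mu : R) :
  (0 < n)%N -> 0 < theta -> 12 * theta < 1 -> 0 < mu ->
  (exists2 y, 2^-1 < y < 1 & 0 < height n theta mu y) ->
  domain (hyp_space R n) (spindle n (height n theta mu)).
Proof.
move=> n0 th0 th12 mu0 y0; split.
- by move=> x [xb _]; rewrite /hyp_space/=; lra.
- exact: open_spindle.
- exact: connected_spindle.
- case: y0 => y yb Fy; exists (y *: delta_mx 0 ord_max); split.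
    by rewrite !mxE !eqxx mulr1.
  rewrite /spindle_fun /axial big1 => [|i im]; last first.
    by rewrite !mxE (negbTE im) andbF mulr0 expr0n.
  by rewrite !mxE !eqxx mulr1 sub0r oppr_lt0.
Qed.

Lemma defining_function_spindle (R : realType) (n : nat) (theta mu : R) (p : 'rV[R]_n.+1) :
  2^-1 < p 0 ord_max < 1 ->
  0 < 4 * axial p + height1 n theta (p 0 ord_max) ^+ 2 ->
  defining_function (spindle n (height n theta mu)) p
    [set x : 'rV[R]_n.+1 | 2^-1 < x 0 ord_max < 1] (spindle_fun (height n theta mu)).
Proof.
move=> pb W0; have p0 : 0 < p 0 ord_max by lra.
split => //.
- rewrite openE => x /andP[x2 x1]; rewrite /interior.
  have c := @continuous_last R n x.
  have n2 : \forall z \near x, 2^-1 < (z : 'rV[R]_n.+1) 0 ord_max by exact: (cvgr_gt _ c).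
  have n1 : \forall z \near x, (z : 'rV[R]_n.+1) 0 ord_max < 1 by exact: (cvgr_lt _ c).
  by apply: filterS2 n2 n1 => z z2 z1; rewrite /= z2 z1.
- move=> k; apply: CkW (@Ck_spindle_fun R n k n theta mu) => x /= xb.
  by rewrite /hyp_space/=; lra.
- by move=> x xb; split=> [[]|].
- apply/existsP; rewrite -[[exists _, _]]negbK negb_exists; apply/negP => /forallP H.
  move: W0; rewrite -(sum_sq_partial_spindle_fun (is_derive_height n theta mu p0)).
  rewrite big1 ?ltxx// => i _.
  by have := H i; rewrite negbK => /eqP ->; rewrite expr0n.
Qed.

(** * Diameter *)

Lemma is_derive_affine (R : realType) (n : nat) (v p : 'rV[R]_n) (s : R) :
  is_derive s 1 (fun s : R => s *: v + p) v.
Proof.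
have de (t : R) i j : is_derive t 1 (fun s => (s *: v + p) i j) (v i j).
  rewrite (_ : (fun s => _) = fun s => s * v i j + p i j); last first.
    by apply/funext => r; rewrite !mxE.
  by apply: is_derive_eq; rewrite /GRing.scale/=; ring.
have dv : derivable (fun s : R => s *: v + p) s 1.
  by apply/derivable_mxP => i j; have [] := de s i j.
apply: DeriveDef => //; rewrite derive_mx//; apply/matrixP => i j.
by rewrite mxE; have e := de s i j; rewrite derive_val.
Qed.

(** The straight segment stays in y >= 1/2, where hyperbolic length is at most twice Euclidean
    length. *)
Lemma rdist_segment_le (R : realType) (n : nat) (p q : 'rV[R]_n.+1) (C : R) :
  2^-1 <= p 0 ord_max -> 2^-1 <= q 0 ord_max ->
  0 <= C -> 4 * \sum_i (q 0 i - p 0 i) ^+ 2 <= C ^+ 2 ->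
  (rdist (hyp_space R n) (hyp_metric R n) p q <= C%:E)%E.
Proof.
move=> p2 q2 C0 qpC; pose c (s : R) := s *: (q - p) + p.
have dc (s : R) : is_derive s 1 c (q - p).
  exact: is_derive_affine.
have c1 : derive1 c = fun=> q - p.
  by apply/funext => s; rewrite derive1E derive_val.
have cl (s : R) : (c s) 0 ord_max = s * (q 0 ord_max - p 0 ord_max) + p 0 ord_max.
  by rewrite !mxE.
have cc (s : R) : {for s, continuous (fun s => (c s) 0 ord_max)}.
  apply: differentiable_continuous; apply/derivable1_diffP.
  have -> : (fun s => (c s) 0 ord_max) =
      fun s => s * (q 0 ord_max - p 0 ord_max) + p 0 ord_max by exact/funext.
  set a := _ - _; set b := p 0 _.
  have d : is_derive s 1 (fun s : R => s * a + b) a.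
    by apply: is_derive_eq; rewrite /GRing.scale/=; ring.
  by have [] := d.
have c2 s : 0 <= s <= 1 -> 2^-1 <= (c s) 0 ord_max by rewrite cl; nra.
have cb : curve_between (hyp_space R n) p q c.
  split.
  - by move=> t; have [] := dc t.
  - by rewrite c1; exact: cst_continuous.
  - by move=> t /c2 ct; rewrite /hyp_space/=; lra.
  - by rewrite /c scale0r add0r.
  - by rewrite /c scale1r subrK.
apply: (@le_trans _ _ (curve_length (hyp_metric R n) c)).
  by apply: ereal_inf_lbound; exists c.
rewrite /curve_length c1.
set S := \sum_i (q 0 i - p 0 i) ^+ 2 in qpC.
have S0 : 0 <= S by apply: sumr_ge0 => i _; exact: sqr_ge0.
have iE s : inner (hyp_metric R n) (c s) (q - p) (q - p) = ((c s) 0 ord_max)^-1 ^+ 2 * S.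
  rewrite inner_hyp exprVn; congr (_ * _); apply: eq_bigr => i _.
  by rewrite !mxE expr2.
under eq_integral => s _ do rewrite iE.
apply: (@le_trans _ _ (\int[lebesgue_measure]_(s in `[0%R, 1%R]) (cst C%:E) s)%E).
  apply: ge0_le_integral => //.
  - apply/measurable_realfun.measurable_EFinP.
    apply: measurable_realfun.subspace_continuous_measurable_fun => //.
    apply: continuous_in_subspaceT => s; rewrite inE/= in_itv/= => s01.
    have cs0 : (c s) 0 ord_max != 0 by rewrite gt_eqF//; have := c2 s s01; lra.
    apply: (@continuous_comp _ _ _ (fun s => ((c s) 0 ord_max)^-1 ^+ 2 * S) Num.sqrt); last first.
      exact: sqrt_continuous.
    apply: continuousM; last exact: cst_continuous.
    apply: (@continuous_comp _ _ _ (fun s => ((c s) 0 ord_max)^-1) (fun y => y ^+ 2)); last first.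
      exact: exprn_continuous.
    by apply: cvgV => //; exact: cc.
  - move=> s; rewrite /= in_itv/= lee_fin => s01.
    have := c2 s s01; set y := (c s) 0 ord_max => y2.
    rewrite -(ger0_norm C0) -sqrtr_sqr; apply: ler_wsqrtr; apply: le_trans qpC.
    apply: ler_wpM2r => //.
    have -> : 4 = 2 ^+ 2 :> R by ring.
    apply: lerXn2r; rewrite ?nnegrE ?invr_ge0//; first lra.
    by rewrite -[leRHS]invrK lef_pV2 ?posrE//; lra.
rewrite integral_cst//= lebesgue_measure_itv/= lte_fin ltr01 oppr0 adde0 mule1.
exact: lexx.
Qed.

(** The squared Euclidean distance is at most 36 theta^2 vertically plus 2 (3 + 3) theta^2
    horizontally, and 4 * 48 <= 14^2. *)
Lemma diam_spindle_le (R : realType) (n : nat) (theta mu : R) :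
  (0 < n)%N -> 0 < theta -> 12 * theta < 1 -> 0 < mu ->
  (diam (hyp_space R n) (hyp_metric R n) (spindle n (height n theta mu))
    <= (14 * theta)%:E)%E.
Proof.
move=> n0 th0 th12 mu0; apply: ge_ereal_sup => _ [[p q] [/= pO qO] <-].
have bd x : spindle n (height n theta mu) x ->
    [/\ 2^-1 <= x 0 ord_max, 0 < 1 - x 0 ord_max < 6 * theta & axial x <= 3 * theta ^+ 2].
  move=> [xb /ltW xr].
  have xb' : 2^-1 <= x 0 ord_max <= 1 by lra.
  have [_ t6 aF] := spindle_height n0 th0 th12 mu0 xb' xr.
  split => //; first lra.
  have P := profile_height mu n0 (ltac:(lra) : 0 < theta <= 4^-1).
  have t01 : 0 <= 1 - x 0 ord_max <= 2^-1 by lra.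
  have /andP[_] := profile_bound0 P t01; rewrite subKr => Fu.
  apply: (le_trans aF); apply: (le_trans Fu).
  set t := 1 - x 0 ord_max in t6 *.
  have : theta * t ^+ 2 <= theta * (6 * theta) ^+ 2.
    by rewrite ler_pM2l//; apply: lerXn2r; rewrite ?nnegrE; lra.
  have : 0 <= t ^+ 3 by rewrite exprn_ge0//; lra.
  have : theta ^+ 2 * (12 * theta) <= theta ^+ 2 * 1 by rewrite ler_pM2l ?exprn_gt0//; lra.
  have -> : theta * (6 * theta) ^+ 2 = 3 * (theta ^+ 2 * (12 * theta)) by ring.
  lra.
have [p2 pt pa] := bd p pO; have [q2 qt qa] := bd q qO.
apply: rdist_segment_le => //; first by rewrite mulr_ge0// ltW.
rewrite sum_ord_max.
have : (q 0 ord_max - p 0 ord_max) ^+ 2 <= 36 * theta ^+ 2.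
  have -> : 36 * theta ^+ 2 = (6 * theta) ^+ 2 by ring.
  rewrite -subr_ge0 subr_sqr mulr_ge0//; lra.
have : \sum_(i < n.+1 | i != ord_max) (q 0 i - p 0 i) ^+ 2 <= 2 * (axial p + axial q).
  rewrite /axial -big_split/= mulr_sumr; apply: ler_sum => i _.
  have := sqr_ge0 (q 0 i + p 0 i); lra.
have := sqr_ge0 theta; lra.
Qed.

(** * Horo-convexity, torsion function and failure of concavity *)

Lemma half_powR_bounds (R : realType) (alpha : R) : 2^-1 < alpha ->
  [/\ 4^-1 < expR (- (ln 2 / alpha)), expR (- (ln 2 / alpha)) <= 1 &
      expR (- (ln 2 / alpha)) `^ alpha = 2^-1].
Proof.
move=> a2; have a0 : 0 < alpha by apply: lt_trans a2; rewrite invr_gt0.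
have l2 : 0 < ln 2 :> R by rewrite ln_gt0// ltr1n.
have two : (2 : R) \is Num.pos by rewrite posrE.
split.
(* The hypothesis alpha > 1/2 enters here: 2^(-1/alpha) > 2^(-2). *)
- have <- : expR (- (ln 2 + ln 2)) = 4^-1 :> R.
    by rewrite -lnM// expRN lnK ?posrE ?mulr_gt0// -natrM.
  rewrite ltr_expR ltrN2 ltr_pdivrMr//.
  have : ln 2 * 2^-1 < ln 2 * alpha by rewrite ltr_pM2l.
  lra.
- by rewrite -[leRHS]expR0 ler_expR oppr_le0 divr_ge0 ?(ltW l2) ?(ltW a0).
- rewrite /powR gt_eqF ?expR_gt0// expRK mulrN mulrC divfK ?gt_eqF//.
  by rewrite expRN lnK.
Qed.

Lemma strictly_horoconvex_spindle (R : realType) (n : nat) (theta delta : R) :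
  (0 < n)%N -> 0 < theta -> 12 * theta < 1 -> 0 < delta ->
  delta * height3_bound R n ^+ 2 <= 2^-1 ->
  100 ^+ 4 * height3_bound R n ^+ 6 * theta <= delta ^+ 2 ->
  let Omega := spindle n (height n theta (delta * theta ^+ 3)) in
  (forall p, boundary (hyp_space R n) Omega p -> exists U rho, defining_function Omega p U rho)
  /\ strictly_horoconvex (hyp_space R n) (hyp_metric R n) Omega.
Proof.
move=> n0 th0 th12 d0 dL thd Omega.
have th3 : 0 < theta ^+ 3 by rewrite exprn_gt0.
have mu0 : 0 < delta * theta ^+ 3 by rewrite mulr_gt0.
have th4 : 0 < theta <= 4^-1 by lra.
have P := profile_height (delta * theta ^+ 3) n0 th4.
have L1 := height3_bound_ge1 R n0.
have W p : boundary (hyp_space R n) Omega p ->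
   [/\ 2^-1 < p 0 ord_max < 1, axial p = height n theta (delta * theta ^+ 3) (p 0 ord_max) &
    0 < 4 * axial p + height1 n theta (p 0 ord_max) ^+ 2].
  move=> /(boundary_spindle n0 th0 th12 mu0) [pb aF]; split => //.
  have a0 := axial_ge0 p.
  (* Off the axis the gradient is visibly nonzero; on the axis F = 0, and the convexity margin
     reduces to F'^2 >= theta * mu > 0. *)
  have [a00|aN0] := eqVneq (axial p) 0; last first.
    have : 0 < axial p by rewrite lt_neqAle eq_sym aN0.
    have := sqr_ge0 (height1 n theta (p 0 ord_max)); lra.
  have t01 : 0 <= 1 - p 0 ord_max <= 2^-1 by lra.
  have := profile_sqrt_concave th0 mu0 L1 _ _ P t01; rewrite subKr -aF a00.
  move=> /(_ _ _ (lexx 0)); rewrite sqrrN mulr0 mul0r subr0 mulr0 add0r => H.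
  apply: lt_le_trans (H _ _); first exact: mulr_gt0.
    by lra.
  have : theta ^+ 3 * (delta * height3_bound R n ^+ 2) <= theta ^+ 3 * 2^-1.
    by rewrite ler_pM2l.
  lra.
split=> p /W [pb aF W0].
  by exists [set x : 'rV[R]_n.+1 | 2^-1 < x 0 ord_max < 1],
   (spindle_fun (height n theta (delta * theta ^+ 3))); exact: defining_function_spindle.
exists [set x : 'rV[R]_n.+1 | 2^-1 < x 0 ord_max < 1],
   (spindle_fun (height n theta (delta * theta ^+ 3))).
split; first exact: defining_function_spindle.
move=> e te eN0.
have dF := is_derive_height n theta (delta * theta ^+ 3).
have dF1 := is_derive_height1 n theta.
have p2 : 2^-1 <= p 0 ord_max by lra.
apply: (spindle_horoconvex_at dF dF1 p2 aF) => //; first by rewrite -aF.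
have t01 : 0 <= 1 - p 0 ord_max <= 2^-1 by lra.
have F0 : 0 <= height n theta (delta * theta ^+ 3) (p 0 ord_max) by rewrite -aF axial_ge0.
move=> G E a; have := profile_horoconvex th0 d0 L1 (ltW th12) dL thd P t01.
rewrite subKr => /(_ F0 G E a); rewrite !sqrrN; exact.
Qed.

Lemma torsion_function_spindle (R : realType) (n : nat) (theta mu : R) :
  (0 < n)%N -> 0 < theta -> 12 * theta < 1 -> 0 < mu ->
  torsion_function (hyp_space R n) (hyp_metric R n) (spindle n (height n theta mu))
    (torsion_fun (2 / (n%:R * coefE n theta)) (height n theta mu)).
Proof.
move=> n0 th0 th12 mu0.
have E0 : 0 < coefE n theta.
  have : theta / n%:R <= theta / 1 by rewrite ler_pM2l// lef_pV2 ?posrE ?ltr0n// ler1n.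
  rewrite /coefE; lra.
split.
- apply: CkW (@Ck_torsion_fun R n 2 n _ theta mu) => x [xb _].
  by rewrite /hyp_space/=; lra.
- apply: continuous_in_subspaceT => x; rewrite inE => -[x0 _].
  exact: (@Ck_torsion_fun R n 0 n _ theta mu x x0).
- move=> x [xb _]; apply: laplacian_torsion_height => //; last lra.
  by rewrite gt_eqF.
- move=> x /(boundary_spindle n0 th0 th12 mu0) [_ aF].
  by rewrite /torsion_fun aF subrr mulr0.
Qed.

(** Midpoint concavity between arc lengths om * S and S on the axis would give u(mid)^alpha >=
    u(S)^alpha / 2, after dropping the nonnegative value at om * S. But u(mid) < q u(S) with q^alpha
    = 1/2. *)
Lemma not_geodesically_concave_spindle (R : realType) (n : nat)
    (alpha theta delta om X b : R) :
  (0 < n)%N -> 2^-1 < alpha -> 0 < theta -> 12 * theta < 1 -> 0 < b ->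
  0 < om -> 24 * om <= 4 * expR (- (ln 2 / alpha)) - 1 ->
  0 < X <= 1 -> height3_bound R n * X <= om -> 0 < delta ->
  32 * delta < om ^+ 2 * X ^+ 2 -> n%:R * theta <= om ->
  let F := height n theta (delta * theta ^+ 3) in
  ~ geodesically_concave (hyp_space R n) (hyp_metric R n) (spindle n F)
      (fun x => torsion_fun b F x `^ alpha).
Proof.
move=> n0 a2 th0 th12 b0 om0 omq X01 LX d0 dX nth F conc.
have fin (x y z : R) : 0 <= x -> y < 2^-1 * z ->
  - y <= 2^-1 * - x + (1 - 2^-1) * - z -> False by lra.
have [q4 q1 qa] := half_powR_bounds a2.
set q := expR _ in omq q4 q1 qa.
have a0 : 0 < alpha by lra.
have n1 : 1 <= n%:R :> R by rewrite ler1n.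
have thom : theta <= om by apply: le_trans nth; rewrite ler_peMl// ltW.
have om8 : 0 < om <= 8^-1 by lra.
have th4 : 0 < theta <= 4^-1 by lra.
have P := profile_height (delta * theta ^+ 3) n0 th4; rewrite -/F in P.
pose S := X * theta.
have S0 : 0 < S by case/andP: X01 => X0 _; rewrite mulr_gt0.
have St : S <= theta by case/andP: X01 => _ X1; rewrite ler_piMl// ltW.
have omS : 0 < om * S < S by rewrite mulr_gt0//= gtr_pMl//; lra.
pose v : 'rV[R]_n.+1 := delta_mx 0 ord_max.
have cl (t : R) : (expR t *: v) 0 ord_max = expR t by rewrite !mxE !eqxx mulr1.
have ca (t : R) : axial (expR t *: v) = 0.
  by apply: big1 => i im; rewrite !mxE (negbTE im) andbF mulr0 expr0n.
have Fpos (s : R) : om * S / 2 < s < 2 * S -> 0 < F (expR (- s)).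
  move=> sS; have := profile_vertex_gt0 th0 om8 X01 LX d0 dX thom P sS.
  by rewrite subKr.
have := conc (- (2 * S)) (- (om * S / 2)) _ (@geodesic_vertical R n _ _).
have inO (t : R) : - (2 * S) < t < - (om * S / 2) -> spindle n F (expR t *: v).
  move=> tS; have := Fpos (- t); rewrite opprK => Ft; split.
    rewrite cl; have := expR_ge1Dx t => et; apply/andP; split; first lra.
    by rewrite -expR0 ltr_expR; lra.
  by rewrite /spindle_fun cl ca sub0r oppr_lt0 Ft//; lra.
move=> /(_ inO).
have h0 : 0 <= 2^-1 :> R by lra.
have h1 : 2^-1 <= 1 :> R by lra.
move=> /(_ (Itv01 h0 h1) (- (om * S)) (- S)).
have m0 : - (om * S) \in (`]- (2 * S), - (om * S / 2)[%classic : set R).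
  by apply/mem_set; rewrite /= in_itv/=; lra.
have m1 : - S \in (`]- (2 * S), - (om * S / 2)[%classic : set R).
  by apply/mem_set; rewrite /= in_itv/=; lra.
move=> /(_ m0 m1).
rewrite !convRE /=.
set z := conv _ _ _.
have -> : z = - ((1 + om) / 2 * S).
  transitivity (2^-1 * - (om * S) + (1 - 2^-1) * - S); [by [] | by field].
rewrite /torsion_fun !cl !ca !subr0.
set w1 := b * _ * _; set w0 := b * _ * _; set w2 := b * _ * _.
change (unstable.onem 2^-1) with (1 - 2^-1 : R).
have F1 : 0 < F (expR (- ((1 + om) / 2 * S))) by apply: Fpos; lra.
have F2 : 0 < F (expR (- S)) by apply: Fpos; lra.
have M := profile_midpoint th0 omq q1 om8 X01 LX d0 dX thom P.
(* The loss from the weight y^n between the midpoint and the far end, made small by n * theta <=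
   om. *)
have bn : 1 - om <= expR (- (n%:R * (S - (1 + om) / 2 * S))).
  apply: le_trans (expR_ge1Dx _).
  have : n%:R * S <= n%:R * theta by rewrite ler_pM2l//; lra.
  have : 0 < n%:R * (S + om * S) by rewrite mulr_gt0//; lra.
  lra.
have := M _ bn; rewrite !subKr -/S => H.
have w21 : w1 < q * w2.
  rewrite /w1 /w2.
  have -> : q * (b * expR (- S) ^+ n * F (expR (- S))) =
    b * expR (- ((1 + om) / 2 * S)) ^+ n *
      (q * expR (- (n%:R * (S - (1 + om) / 2 * S))) * F (expR (- S))).
    have -> : expR (- S) ^+ n = expR (- ((1 + om) / 2 * S)) ^+ n *
        expR (- (n%:R * (S - (1 + om) / 2 * S))).
      rewrite -!expRM_natl -expRD; congr expR; ring.
    by ring.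
  by rewrite ltr_pM2l// mulr_gt0// exprn_gt0// expR_gt0.
have w1p : 0 < w1 by rewrite mulr_gt0// mulr_gt0// exprn_gt0// expR_gt0.
have w2p : 0 < w2 by rewrite mulr_gt0// mulr_gt0// exprn_gt0// expR_gt0.
have q0 : 0 < q by rewrite expR_gt0.
have : w1 `^ alpha < (q * w2) `^ alpha.
  by apply: gt0_ltr_powR => //; rewrite nnegrE ltW// mulr_gt0.
rewrite (powRM alpha (ltW q0) (ltW w2p)) qa.
by move=> w21a w012; apply: fin w012; [exact: powR_ge0|exact: w21a].
Qed.

(* The dimension of the hyperbolic space is m.+2. *)
Theorem mainTheorem2 (R : realType) (m : nat) (alpha eps : R)
    (halpha : 2^-1 < alpha) (heps : 0 < eps) :
  exists (Omega : set 'rV[R]_m.+2) (u : 'rV[R]_m.+2 -> R),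
    smooth_domain (hyp_space R m.+1) Omega /\
    (diam (hyp_space R m.+1) (hyp_metric R m.+1) Omega < +oo)%E /\
    strictly_horoconvex (hyp_space R m.+1) (hyp_metric R m.+1) Omega /\
    (diam (hyp_space R m.+1) (hyp_metric R m.+1) Omega < eps%:E)%E /\
    torsion_function (hyp_space R m.+1) (hyp_metric R m.+1) Omega u /\
    ~ geodesically_concave (hyp_space R m.+1) (hyp_metric R m.+1) Omega
        (fun x => u x `^ alpha).
Proof.
pose n := m.+1; have n0 : (0 < n)%N by [].
have n1 : 1 <= n%:R :> R by rewrite ler1n.
pose Lam := height3_bound R n; have L1 : 1 <= Lam := height3_bound_ge1 R n0.
have [q4 q1 _] := half_powR_bounds halpha.
(* The excess of 4 * 2^(-1/alpha) over 1, scaled to the 24 om allowed in [profile_midpoint]; it is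
   positive as alpha > 1/2, and at most 3/24 = 1/8. *)
pose om := (4 * expR (- (ln 2 / alpha)) - 1) / 24.
have om0 : 0 < om <= 8^-1 by rewrite /om; lra.
have omq : 24 * om <= 4 * expR (- (ln 2 / alpha)) - 1 by rewrite /om; lra.
case/andP: om0 => om0 om8.
pose X := om / Lam.
have Lam0 : 0 < Lam by lra.
have X0 : 0 < X by rewrite divr_gt0.
have XL : X * Lam = om by rewrite /X divfK// gt_eqF.
have X1 : X <= 1 by rewrite /X ler_pdivrMr// mul1r; lra.
(* Half of the bound om^2 X^2 / 32, so that the inequality is strict. *)
pose delta := om ^+ 2 * X ^+ 2 / 64.
have oX : 0 < om ^+ 2 * X ^+ 2 by rewrite mulr_gt0// exprn_gt0.
have d0 : 0 < delta by rewrite divr_gt0.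
have dX : 32 * delta < om ^+ 2 * X ^+ 2 by rewrite /delta; lra.
have dL : delta * Lam ^+ 2 <= 2^-1.
  have -> : delta * Lam ^+ 2 = om ^+ 4 / 64 by rewrite /delta -XL; field.
  have : om ^+ 4 <= 1 by rewrite exprn_ile1//; lra.
  lra.
pose D := 100 ^+ 4 * Lam ^+ 6.
have D0 : 0 < D by apply: mulr_gt0; apply: exprn_gt0 => //; lra.
(* In turn: horo-convexity, near-constancy of the weight y^n on the tested segment, 12 theta < 1,
   and 14 theta < eps for the diameter. *)
pose theta := Num.min (Num.min (delta ^+ 2 / D) (om / n%:R)) (Num.min 13^-1 (eps / 15)).
have np : 0 < n%:R :> R by lra.
have th0 : 0 < theta.
  by rewrite !lt_min (divr_gt0 om0 np) (divr_gt0 heps)// invr_gt0 ltr0n divr_gt0// exprn_gt0.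
have th1 : theta <= delta ^+ 2 / D by rewrite !ge_min lexx.
have th2 : theta <= om / n%:R by rewrite !ge_min lexx !orbT.
have th3 : theta <= 13^-1 by rewrite !ge_min lexx !orbT.
have th4 : theta <= eps / 15 by rewrite !ge_min lexx !orbT.
have th12 : 12 * theta < 1 by lra.
have thd : D * theta <= delta ^+ 2 by rewrite mulrC -ler_pdivlMr.
have nth : n%:R * theta <= om by rewrite mulrC -ler_pdivlMr.
pose mu := delta * theta ^+ 3.
have mu0 : 0 < mu by rewrite mulr_gt0// exprn_gt0.
have E0 : 0 < coefE n theta.
  have : theta / n%:R <= theta / 1 by rewrite ler_pM2l// lef_pV2 ?posrE.
  rewrite /coefE; lra.
have [db hc] := strictly_horoconvex_spindle n0 th0 th12 d0 dL thd.
have dm := @diam_spindle_le R n theta mu n0 th0 th12 mu0.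
have LX : Lam * X <= om by rewrite mulrC XL.
exists (spindle n (height n theta mu)),
  (torsion_fun (2 / (n%:R * coefE n theta)) (height n theta mu)).
split; last split; last split; last split; last split.
- split; last exact: db.
  apply: domain_spindle => //; exists (expR (- (X * theta))).
    have Xt : 0 < X * theta <= theta by rewrite mulr_gt0//= ler_piMl// ltW.
    have := expR_ge1Dx (- (X * theta)).
    have : expR (- (X * theta)) < expR 0 by rewrite ltr_expR; lra.
    rewrite expR0; lra.
  have th14 : 0 < theta <= 4^-1 by lra.
  have P := profile_height mu n0 th14.
  have om08 : 0 < om <= 8^-1 by rewrite om0.
  have X01 : 0 < X <= 1 by rewrite X0.
  have thom : theta <= om by apply: le_trans nth; rewrite ler_peMl// ltW.
  have sX : om * (X * theta) / 2 < X * theta < 2 * (X * theta).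
    have : 0 < X * theta by rewrite mulr_gt0.
    have : om * (X * theta) <= 8^-1 * (X * theta) by rewrite ler_pM2r// mulr_gt0.
    lra.
  by have := profile_vertex_gt0 th0 om08 X01 LX d0 dX thom P sX; rewrite subKr.
- exact: le_lt_trans dm (ltry _).
- exact: hc.
- by apply: le_lt_trans dm _; rewrite lte_fin; lra.
- exact: torsion_function_spindle.
- apply: (not_geodesically_concave_spindle n0 halpha th0 th12 _ om0 omq _ LX d0 dX nth).
    by rewrite divr_gt0// mulr_gt0.
  by rewrite X0.
Qed.
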